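(* Let $\Omega\subset\mathbb{R}^N$ be a bounded domain, let $\sigma>0$ not be an eigenvalue of the Laplacian on $\Omega$ with homogeneous Dirichlet boundary condition, and let $u\in L^2(\Omega)$, $u\neq0$. With $\lambda_u^\sigma$, $\lambda_u^\tau$, $e_u^\sigma$, $\phi_n$, $\psi_n$, $u_n$ and $\mathcal{R}$ as defined in the context: (i) We have $$\|\psi_n\|_2\leqslant\left|\frac{\lambda_u^\sigma-\sigma}{\lambda_u^\tau-\sigma}\right|^n\|u\|_2 .$$ In particular, $\psi_n\to 0$ in $L^2(\Omega)$ with an exponential rate. (ii) There exists $n_0\in\mathbb{N}$ such that $$\left\|\frac{e_u^\sigma+\psi_n}{\|e_u^\sigma+\psi_n\|_2}-\frac{e_u^\sigma}{\|e_u^\sigma\|_2}\right\|_2\leqslant\frac{4}{\|e_u^\sigma\|_2}\|\psi_n\|_2$$ for all $n\geqslant n_0$. In particular, $$\frac{e_u^\sigma+\psi_n}{\|e_u^\sigma+\psi_n\|_2}\to\frac{e_u^\sigma}{\|e_u^\sigma\|_2}\quad\text{in } L^2(\Omega)$$ with an exponential rate. (iii) The following convergences hold: $$\frac{\|\phi_n\|_2}{\|\phi_{n+1}\|_2}\to|\lambda_u^\sigma-\sigma|,\qquad u_n\to e_u^\sigma\ \text{ in } L^2(\Omega),\qquad \mathcal{R}(\phi_n)\to\lambda_u^\sigma,$$ the last one with $$\mathcal{R}(\phi_n)-\lambda_u^\sigma=O\left(\left|\frac{\lambda_u^\sigma-\sigma}{\lambda_u^\tau-\sigma}\right|^{2n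}\right).$$
   Context: $\|\cdot\|_2$ and $\langle\cdot,\cdot\rangle_2$ are the norm and inner product of $L^2(\Omega)$ (real-valued functions). Eigenvalues and eigenfunctions of the Laplacian on $\Omega$ are those of the problem $-\Delta e=\lambda e$ in $\Omega$, $e=0$ on $\partial\Omega$, with $e\in H_0^1(\Omega)$. The function $u$ is written in terms of its nonzero components in the eigenspaces of the Laplacian as $u=\sum_{j=1}^M e_u^j$, where $M$ is a positive integer or $M=\infty$; here $0<\lambda_u^1<\lambda_u^2<\cdots$ are the distinct eigenvalues whose eigenspaces are not orthogonal to $u$, and $e_u^j$ is the orthogonal projection of $u$ on the $\lambda_u^j$-eigenspace. $\lambda_u^\sigma$ is the eigenvalue appearing in this decomposition of $u$ which is closest to $\sigma$, i.e. $|\lambda_u^\sigma-\sigma|=\min_{j}|\lambda_u^j-\sigma|$; $e_u^\sigma$ is the projection of $u$ on the $\lambda_u^\sigma$-eigenspace; $\lambda_u^\tau$ is the eigenvalue appearing in the decomposition of $u$ which is second closest to $\sigma$, i.e. $|\lambda_u^\tau-\sigma|=\min_{j:\ \lambda_u^j\neq\lambda_u^\sigma}|\lambda_u^j-\sigma|$. Inverse iteration with shift: $\Delta_\sigma:=\Delta+\sigma I$, where $I$ is the identity; $\phi_0:=u$, and $\phi_{n+1}\in H_0^1(\Omega)$ is the solution of $-\Delta_\sigma\phi_{n+1}=\phi_n$ in $\Omega$, $\phi_{n+1}=0$ on $\partial\Omega$. $$\psi_n:=\sum_{|\lambda_u^j-\sigma|>|\lambda_u^\sigma-\sigma|}\left(\frac{\lambda_u^\sigma-\sigma}{\lambda_u^j-\sigma}\right)^n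 e_u^j .$$ $u_n:=\left\langle u,\frac{\phi_n}{\|\phi_n\|_2}\right\rangle_2\frac{\phi_n}{\|\phi_n\|_2}$ is the component of $u$ in the direction of $\phi_n/\|\phi_n\|_2$. The Rayleigh quotient is $\mathcal{R}(v)=\int_\Omega|\nabla v|^2\,dx\big/\int_\Omega v^2\,dx$ for $v\in H_0^1(\Omega)\setminus\{0\}$. Convergence ''with an exponential rate'' means that the norm of the difference is at most $Cq^n$ for all large $n$, for some constants $C>0$ and $0<q<1$.
   Formalization: The convergences of u_n to e_u^σ and of R(φ_n) to λ_u^σ are stated when λ_u^σ is the unique closest eigenvalue to σ; they fail whenever two eigenvalues of the decomposition are equally close. Estimates with λ_u^τ are stated whenever it exists. *)

(* Defs.v *)
From HB Require Import structures.
From mathcomp Require Import all_boot all_order all_algebra.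
From mathcomp Require Import all_classical all_reals all_analysis.
From mathcomp Require Import measurable_realfun.
Set Implicit Arguments.
Unset Strict Implicit.
Unset Printing Implicit Defensive.
Import Order.TTheory GRing.Theory Num.Theory.
Import numFieldNormedType.Exports.
Local Open Scope classical_set_scope.
Local Open Scope ring_scope.

Section Lebesgue.
Context {R : realType}.

Definition cons_tuple n (p : measurableTypeR R * n.-tuple (measurableTypeR R)) : n.+1.-tuple (measurableTypeR R) :=
  [tuple of p.1 :: p.2].

Lemma measurable_cons_tuple n : measurable_fun setT (@cons_tuple n).
Proof. exact: measurable_cons. Qed.

Section step.
Variables (n : nat) (m : {sigma_finite_measure set (n.-tuple (measurableTypeR R)) -> \bar R}).

Definition lebesgue_cons : set (n.+1.-tuple (measurableTypeR R)) -> \bar R :=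
  pushforward (lebesgue_measure \x m)%E (@cons_tuple n).

Let lebesgue_cons_measure : {measure set (n.+1.-tuple (measurableTypeR R)) -> \bar R} :=
  measure_function_pushforward__canonical__measure_function_Measure
    (lebesgue_measure \x m)%E (@measurable_cons_tuple n).

HB.instance Definition _ := Measure.copy lebesgue_cons lebesgue_cons_measure.

Let sigma_finite_lebesgue_cons : sigma_finite setT lebesgue_cons.
Proof.
have /sigma_finiteP[F [TF ndF Foo]] := sigma_finiteT (@lebesgue_measure R).
have /sigma_finiteP[G [TG ndG Goo]] := sigma_finiteT m.
exists (fun k => [set t : n.+1.-tuple (measurableTypeR R) | F k (thead t) /\
    G k [tuple of behead t]]).
  apply/esym; rewrite -subTset => t _.
  have [i _ Fi] : (\bigcup_k F k) (thead t) by rewrite -TF.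
  have [j _ Gj] : (\bigcup_k G k) [tuple of behead t] by rewrite -TG.
  exists (maxn i j) => //; split.
    by move: Fi; exact/subsetPset/ndF/leq_maxl.
  by move: Gj; exact/subsetPset/ndG/leq_maxr.
move=> k; have [mF Fk] := Foo k; have [mG Gk] := Goo k; split.
  apply: measurableI; rewrite -[X in measurable X]setTI.
    exact: (@measurable_tnth _ _ n.+1 ord0).
  exact: measurable_behead.
rewrite /lebesgue_cons /pushforward.
rewrite [X in product_measure1 _ _ X](_ : _ = F k `*` G k); last first.
  have beh x t : [tuple of behead (@cons_tuple n (x, t))] = t by exact/val_inj.
  by apply/seteqP; split => -[x t] /=; rewrite theadE beh.
by rewrite product_measure1E// lte_mul_pinfty// ge0_fin_numE.
Qed.

HB.instance Definition _ := Measure_isSigmaFinite.Build _ _ _ lebesgue_cons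
  sigma_finite_lebesgue_cons.

End step.

Fixpoint lebesgue_tuple n : {sigma_finite_measure set (n.-tuple (measurableTypeR R)) -> \bar R} :=
  if n is n'.+1 then lebesgue_cons (lebesgue_tuple n') else dirac [tuple].

HB.instance Definition _ (N : nat) :=
  Measurable.copy 'rV[R]_N (g_sigma_algebraType (@open 'rV[R]_N)).

Lemma open_measurable_rV N (A : set 'rV[R]_N) : open A -> measurable A.
Proof. exact: sub_sigma_algebra. Qed.

Definition row_of_tuple n (t : n.-tuple (measurableTypeR R)) : 'rV[R]_n :=
  \row_i tnth t i.

Lemma measurable_row_of_tuple n : measurable_fun setT (@row_of_tuple n).
Proof.
apply: (@measurability _ _ _ _ _ _ (@open 'rV[R]_n)) => //.
move=> _ [A oA <-]; rewrite setTI.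
pose B (p : 'rV[rat]_n * nat) : set 'rV[R]_n :=
  [set x | forall i, `|ratr (p.1 0 i) - x 0 i| < p.2.+1%:R^-1].
pose F p : set 'rV[R]_n := [set x | B p x /\ B p `<=` A].
rewrite (_ : _ @^-1` _ = \bigcup_p (row_of_tuple (n := n) @^-1` F p)); last first.
  rewrite -preimage_bigcup; congr (_ @^-1` _); apply/seteqP; split => [x Ax|x].
    have /nbhs_ballP[r /= r0 rA] : nbhs x A by exact: open_nbhs_nbhs.
    have [k kr] : exists k : nat, k.+1%:R^-1 < r / 2.
      have /ltr_add_invr[k] : 0 < r / 2 by rewrite divr_gt0.
      by rewrite add0r; exists k.
    have /(_ _)/cid-/all_sig[q qx] : forall i, exists q : rat,
        `|ratr q - x 0 i| < k.+1%:R^-1.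
      move=> i; have /rat_in_itvoo[q] : x 0 i - k.+1%:R^-1 < x 0 i + k.+1%:R^-1.
        by rewrite ltrD2l gtrN// invr_gt0.
      by rewrite in_itv/= -ltr_distl; exists q.
    exists (\row_i q i, k) => //; split => [i|y By]; first by rewrite mxE/= qx.
    apply: rA; split => // i j; rewrite ord1 /ball/=.
    have := By j; rewrite /= mxE => qy.
    rewrite -(subrK (ratr (q j)) (x 0 j)) -addrA (le_lt_trans (ler_normD _ _))//.
    rewrite [ltRHS](splitr r) ltrD// ?(lt_trans qy)//.
    by rewrite distrC (lt_trans (qx j)).
  by move=> [p _ [Bpx]]; exact.
apply: countable_bigcupT_measurable; first exact: countableP.
move=> p; have [pA|pA] := pselect (B p `<=` A); last first.
  by rewrite (_ : _ @^-1` _ = set0)// -subset0 => t [_ /pA].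
rewrite (_ : _ @^-1` _ = \bigcap_(i in [set: 'I_n])
    (fun t : n.-tuple (measurableTypeR R) => tnth t i) @^-1`
      [set x | `|ratr (p.1 0 i) - x| < p.2.+1%:R^-1]); last first.
  apply/seteqP; split => [t [Bt _] i _|t Bt]; first by have := Bt i; rewrite mxE.
  by split => // i; rewrite mxE; exact: Bt.
apply: fin_bigcap_measurable; first exact: finite_finset.
move=> i _; rewrite -[X in measurable X]setTI.
apply: measurable_tnth => //.
rewrite (_ : mkset _ = ball (ratr (p.1 0 i) : R) p.2.+1%:R^-1)//.
exact: measurable_ball.
Qed.

Definition lebesgue_rV n : set 'rV[R]_n -> \bar R :=
  pushforward (lebesgue_tuple n) (@row_of_tuple n).

Let lebesgue_rV_measure n : {measure set 'rV[R]_n -> \bar R} :=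
  measure_function_pushforward__canonical__measure_function_Measure
    (lebesgue_tuple n) (@measurable_row_of_tuple n).

HB.instance Definition _ n :=
  Measure.copy (@lebesgue_rV n) (lebesgue_rV_measure n).

End Lebesgue.

Record bounded_domain (R : realType) (N : nat) := BoundedDomain {
  domain_set :> set 'rV[R]_N ;
  domain_open : open domain_set ;
  domain_connected : connected domain_set ;
  domain_nonempty : domain_set !=set0 ;
  domain_bounded : bounded_set domain_set }.
Arguments domain_open {R N} b.
Arguments domain_connected {R N} b.
Arguments domain_nonempty {R N} b.
Arguments domain_bounded {R N} b.

Section DirichletLaplacian.
Context {R : realType} {N : nat}.
Variable Omega : bounded_domain R N.

Local Notation fn := ('rV[R]_N -> R).

Definition lebesgue_on : {measure set 'rV[R]_N -> \bar R} :=
  mrestr (@lebesgue_rV R N) (open_measurable_rV (domain_open Omega)).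

(* L^2(Omega) is handled through representatives defined on the whole of R^N;
   only their values on Omega matter, as they are integrated against the
   restriction of Lebesgue measure to Omega. *)
Definition L2 : {pred fn} := Lfun lebesgue_on 2%:E.

Definition inner2 (f g : fn) : R := \int[lebesgue_on]_x (f x * g x).

Definition norm2 (f : fn) : R := fine (Lnorm lebesgue_on 2%:E (EFin \o f)).

Definition cvg2 (f_ : nat -> fn) (f : fn) : Prop :=
  norm2 (f_ n \- f) @[n --> \oo] --> 0.

Definition exp_cvg2 (f_ : nat -> fn) (f : fn) : Prop :=
  cvg2 f_ f /\
  exists C q : R, [/\ 0 < C, 0 < q < 1 &
    \forall n \near \oo, norm2 (f_ n \- f) <= C * q ^+ n].

(* The sum in L^2(Omega) of the series of the f_ j; its value is immaterial
   when the series diverges. *)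
Definition sum2 (f_ : nat -> fn) : fn :=
  xget (fun=> 0)
    [set f | f \in L2 /\ cvg2 (fun n x => \sum_(j < n) f_ j x) f].

Definition normalize2 (f : fn) : fn := fun x => f x / norm2 f.

Definition partial (i : 'I_N) (f : fn) : fn :=
  fun x => 'D_(delta_mx 0 i) f x.

(* All iterated partial derivatives exist and are continuous. *)
Definition smooth (f : fn) : Prop := forall l : seq 'I_N,
  continuous (foldr partial f l) /\
  forall x i, derivable (foldr partial f l) x (delta_mx 0 i).

Definition test_function (v : fn) : Prop :=
  [/\ smooth v, compact (closure [set x | v x != 0]) &
      closure [set x | v x != 0] `<=` Omega].

Definition weak_gradient (f : fn) (G : 'I_N -> fn) : Prop :=
  forall i v, test_function v -> inner2 f (partial i v) = - inner2 (G i) v.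

(* f belongs to H^1_0(Omega), the closure of the test functions for the norm of
   H^1(Omega), and its weak gradient is G. *)
Definition H10_with_gradient (f : fn) (G : 'I_N -> fn) : Prop :=
  [/\ f \in L2, forall i, G i \in L2, weak_gradient f G &
   exists v_ : nat -> fn, [/\ forall k, test_function (v_ k), cvg2 v_ f &
     forall i, cvg2 (fun k => partial i (v_ k)) (G i)]].

Definition H10 : set fn := [set f | exists G, H10_with_gradient f G].

(* A representative of the weak gradient of f in H^1_0(Omega), which is unique
   up to equality almost everywhere. *)
Definition gradient (f : fn) : 'I_N -> fn :=
  xget (fun _ _ => 0) [set G | H10_with_gradient f G].

Definition dirichlet_form (f g : fn) : R :=
  \int[lebesgue_on]_x (\sum_i gradient f i x * gradient g i x).

Definition rayleigh (v : fn) : R :=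
  (\int[lebesgue_on]_x (\sum_i gradient v i x ^+ 2)) /
  (\int[lebesgue_on]_x (v x ^+ 2)).

(* Weak solutions w of - Delta w - sigma w = f in Omega, w = 0 on the boundary. *)
Definition shifted_solution (sigma : R) (f w : fn) : Prop :=
  H10 w /\ forall v, H10 v ->
    dirichlet_form w v - sigma * inner2 w v = inner2 f v.

Definition eigenspace (lambda : R) : set fn :=
  [set e | H10 e /\ forall v, H10 v ->
    dirichlet_form e v = lambda * inner2 e v].

Definition is_eigenvalue (lambda : R) : Prop :=
  exists2 e, eigenspace lambda e & norm2 e != 0.

Definition is_eigenprojection (lambda : R) (u p : fn) : Prop :=
  eigenspace lambda p /\
  forall v, eigenspace lambda v -> inner2 (u \- p) v = 0.

(* u = sum_j e_u^j with lambda_u^1 < lambda_u^2 < ... exactly the eigenvalues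
   whose eigenspaces are not orthogonal to u, and e_u^j the projections of u.
   The indices of lambda_u^j and e_u^j start at 0 and M = None stands
   for M = oo; the values of lam and e outside the range are irrelevant. *)
Definition in_range (M : option nat) (j : nat) : bool :=
  if M is Some m then (j < m)%N else true.

Record eigen_decomposition (u : fn) (M : option nat) (lam : nat -> R)
    (e : nat -> fn) : Prop := EigenDecomposition {
  lam_gt0 : forall j, in_range M j -> 0 < lam j ;
  lam_increasing : forall i j, in_range M j -> (i < j)%N -> lam i < lam j ;
  lam_spec : forall lambda,
    (is_eigenvalue lambda /\
       exists2 v, eigenspace lambda v & inner2 u v != 0) <->
    (exists2 j, in_range M j & lambda = lam j) ;
  e_spec : forall j, in_range M j -> is_eigenprojection (lam j) u (e j) ;
  sum_spec :
    cvg2 (fun n x => \sum_(j < n | in_range M j) e j x) u }.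

(* The index of lambda_u^sigma. *)
Definition closest_index (M : option nat) (lam : nat -> R) (sigma : R)
    (s : nat) : Prop :=
  in_range M s /\
  forall j, in_range M j -> `|lam s - sigma| <= `|lam j - sigma|.

(* The index of lambda_u^tau, when s is that of lambda_u^sigma. *)
Definition second_closest_index (M : option nat) (lam : nat -> R) (sigma : R)
    (s t : nat) : Prop :=
  [/\ in_range M t, lam t != lam s & forall j, in_range M j ->
    lam j != lam s -> `|lam t - sigma| <= `|lam j - sigma|].

Definition psi (M : option nat) (lam : nat -> R) (e : nat -> fn) (sigma : R)
    (s n : nat) : fn :=
  sum2 (fun j x =>
    if in_range M j && (`|lam s - sigma| < `|lam j - sigma|)
    then ((lam s - sigma) / (lam j - sigma)) ^+ n * e j x else 0).

Definition inverse_iteration (sigma : R) (u : fn) (phi : nat -> fn) : Prop :=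
  phi 0%N = u /\ forall n, shifted_solution sigma (phi n) (phi n.+1).

(* u_n is component u (phi_n). *)
Definition component (u f : fn) : fn :=
  fun x => inner2 u (normalize2 f) * normalize2 f x.

End DirichletLaplacian.

(* Main.v *)
Require Import Defs.
From HB Require Import structures.
From mathcomp Require Import all_boot all_order all_algebra.
From mathcomp Require Import all_classical all_reals all_analysis.
From mathcomp Require Import measurable_realfun ring lra.
Set Implicit Arguments.
Unset Strict Implicit.
Unset Printing Implicit Defensive.
Import Order.TTheory GRing.Theory Num.Theory.
Import numFieldNormedType.Exports.
Local Open Scope classical_set_scope.
Local Open Scope ring_scope.

(** Each step of the iteration divides the component of u in the
    lam j - eigenspace by lam j - sigma.  Rescaled by (lam s - sigma)^n, the
    iterate is therefore the series x_n = sum_j rho_j^n e_j, where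
    rho_j = (lam s - sigma) / (lam j - sigma) has modulus at most 1 and
    rho_s = 1, and psi_n collects its terms with |rho_j| < 1.  By Parseval's
    identity, norms and inner products of such series are sums of scalar
    terms, which gives the decay of psi_n, the limit of the norm ratios and
    the limit of the projections [component u (phi n)], the latter depending
    only on the line spanned by phi n.

    The Rayleigh quotient is an inner product of consecutive iterates:
    testing the equation of phi_(n+1) with phi_(n+1) itself gives
    R(phi_(n+1)) = sigma + <phi_n, phi_(n+1)> / |phi_(n+1)|^2
    ([rayleigh_iterate]).  Writing x_n = e_s + r_n with r_n orthogonal to
    e_s, the linear terms in r_n cancel and the error is quadratic in r_n
    ([ler_consecutive]); hence the exponent 2n.

    Two points are not formal.

    First, phi_n must be shown to be the expected series ([solves_expands]).
    The partial sums of the candidate series solve the shifted problem with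
    the partial sums of the data on the right-hand side.  The Dirichlet form
    is closed, that is, H^1_0 is complete, so the equation passes to the limit
    ([solves_closed]), and the solution is unique because sigma is not an
    eigenvalue.  Closedness rests on the completeness of L^2
    ([L2_complete]) and on the uniqueness of the gradient of an H^1_0
    function ([gradient_of_null]).

    Second, an exponential rate requires a bound q < 1 for all the ratios
    |rho_j| < 1 ([rho_gap]).  It comes from the monotonicity of lam and from
    the existence of an eigenvalue closest to sigma: past the first index j
    with lam j > sigma the ratios decrease, and if all lam j are below
    sigma then s is the last index.

    The Hilbert space part is carried out in a semi-inner product space, whose
    vectors will be square-integrable functions rather than their classes
    modulo equality almost everywhere. *)

(** * Semi-inner product spaces *)

(** Positive definiteness is left out on purpose: functions that agree almost
    everywhere remain distinct vectors, and limits are unique only up to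
    vectors of norm zero. *)
Record semi_inner (R : realType) (V : lmodType R) := SemiInner {
  dot :> V -> V -> R ;
  dotC : forall x y, dot x y = dot y x ;
  dot_linear : forall z a x y, dot (a *: x + y) z = a * dot x z + dot y z ;
  dot_ge0 : forall x, 0 <= dot x x }.

Section SemiInnerTheory.
Context {R : realType} {V : lmodType R} (d : semi_inner V).
Implicit Types (x y z : V) (a : R).

Lemma dotDl z x y : d (x + y) z = d x z + d y z.
Proof. by have := dot_linear d z 1 x y; rewrite scale1r mul1r. Qed.

Lemma dot0l z : d 0 z = 0.
Proof. by apply: (addrI (d 0 z)); rewrite -dotDl !addr0. Qed.

Lemma dotZl z a x : d (a *: x) z = a * d x z.
Proof. by have := dot_linear d z a x 0; rewrite dot0l !addr0. Qed.

Lemma dotBl z x y : d (x - y) z = d x z - d y z.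
Proof. by rewrite dotDl -scaleN1r dotZl mulN1r. Qed.

Lemma dot_suml z n (x : nat -> V) : d (\sum_(j < n) x j) z = \sum_(j < n) d (x j) z.
Proof. by elim/big_ind2: _ => [|? ? ? ? <- <-|]; rewrite ?dot0l ?dotDl. Qed.

Lemma dotDr z x y : d z (x + y) = d z x + d z y.
Proof. by rewrite !(dotC d z) dotDl. Qed.

Lemma dot0r z : d z 0 = 0. Proof. by rewrite dotC dot0l. Qed.

Lemma dotZr z a x : d z (a *: x) = a * d z x.
Proof. by rewrite !(dotC d z) dotZl. Qed.

Lemma dotBr z x y : d z (x - y) = d z x - d z y.
Proof. by rewrite !(dotC d z) dotBl. Qed.

Definition nrm x : R := Num.sqrt (d x x).

Lemma nrm_ge0 x : 0 <= nrm x. Proof. exact: sqrtr_ge0. Qed.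

Lemma sqr_nrm x : nrm x ^+ 2 = d x x.
Proof. by rewrite sqr_sqrtr ?dot_ge0. Qed.

Lemma nrmZ a x : nrm (a *: x) = `|a| * nrm x.
Proof.
by rewrite /nrm dotZl dotZr mulrA -expr2 sqrtrM ?sqr_ge0// sqrtr_sqr.
Qed.

Lemma nrm0 : nrm 0 = 0. Proof. by rewrite /nrm dot0l sqrtr0. Qed.

Lemma nrmN x : nrm (- x) = nrm x.
Proof. by rewrite -scaleN1r nrmZ normrN1 mul1r. Qed.

Lemma nrm_subC x y : nrm (x - y) = nrm (y - x).
Proof. by rewrite -nrmN opprB. Qed.

(** Cauchy-Schwarz: the norm of x + t y is nonnegative for every t. *)
Lemma dot_le_nrm x y : `|d x y| <= nrm x * nrm y.
Proof.
have P t : 0 <= d x x + 2 * t * d x y + t ^+ 2 * d y y.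
  have := dot_ge0 d (x + t *: y).
  rewrite dotDl !dotDr !dotZl !dotZr (dotC d y x).
  by congr (_ <= _); ring.
rewrite -(@ler_pXn2r _ 2) ?nnegrE ?mulr_ge0 ?nrm_ge0//.
rewrite exprMn !sqr_nrm real_normK ?num_real//.
have [y0|y0] := eqVneq (d y y) 0.
  have [->|xy0] := eqVneq (d x y) 0; first by rewrite expr0n/= y0 mulr0.
  (* The polynomial is affine in t; this t would give it the value -1. *)
  have := P (- (d x x + 1) / (2 * d x y)); rewrite y0.
  rewrite [X in 0 <= X](_ : _ = -1) ?ler0N1//.
  by field.
have {}y0 : 0 < d y y by rewrite lt0r y0 dot_ge0.
(* The minimum of the polynomial. *)
have := P (- (d x y) / d y y).
rewrite [X in 0 <= X](_ : _ = (d x x * d y y - d x y ^+ 2) / d y y); last first.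
  by field; rewrite gt_eqF.
by rewrite pmulr_lge0 ?invr_gt0// subr_ge0.
Qed.

Lemma ler_nrmD x y : nrm (x + y) <= nrm x + nrm y.
Proof.
rewrite -(@ler_pXn2r _ 2) ?nnegrE ?addr_ge0 ?nrm_ge0//.
rewrite sqrrD !sqr_nrm dotDl !dotDr (dotC d y x).
have := le_trans (ler_norm _) (dot_le_nrm x y); lra.
Qed.

Lemma ler_dist_nrm x y : `|nrm x - nrm y| <= nrm (x - y).
Proof.
rewrite ler_norml lerBlDr lerBrDl; apply/andP; split.
  by rewrite lerBlDr nrm_subC (le_trans _ (ler_nrmD _ _))// addrC subrK.
by rewrite (le_trans _ (ler_nrmD _ _))// subrK.
Qed.

Lemma nrm0_dotl x y : nrm x = 0 -> d x y = 0.
Proof.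
by move=> x0; apply/eqP; rewrite -normr_le0 (le_trans (dot_le_nrm _ _))// x0 mul0r.
Qed.

Definition ncvg (x_ : nat -> V) x : Prop := nrm (x_ n - x) @[n --> \oo] --> 0.

Lemma ncvg_le (x_ : nat -> V) x (b : nat -> R) :
  (forall n, nrm (x_ n - x) <= b n) -> b n @[n --> \oo] --> 0 -> ncvg x_ x.
Proof.
move=> xb b0; apply: (@squeeze_cvgr _ _ _ _ (fun=> 0) b) => //.
  by near=> n; rewrite nrm_ge0 xb.
exact: cvg_cst.
Unshelve. all: by end_near. Qed.

Lemma ncvg_cst x : ncvg (fun=> x) x.
Proof. by rewrite /ncvg subrr nrm0; exact: cvg_cst. Qed.

Lemma ncvg_lin a (x_ y_ : nat -> V) x y : ncvg x_ x -> ncvg y_ y ->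
  ncvg (fun n => a *: x_ n + y_ n) (a *: x + y).
Proof.
move=> xx yy; apply: (@ncvg_le _ _ (fun n => `|a| * nrm (x_ n - x) + nrm (y_ n - y))).
  move=> n; rewrite opprD addrACA -scalerBr (le_trans (ler_nrmD _ _))//.
  by rewrite nrmZ.
rewrite -[0](addr0 0) -[X in X + _](mulr0 `|a|).
by apply: cvgD => //; apply: cvgM => //; exact: cvg_cst.
Qed.

Lemma ncvgB (x_ y_ : nat -> V) x y : ncvg x_ x -> ncvg y_ y ->
  ncvg (fun n => x_ n - y_ n) (x - y).
Proof.
move=> xx yy; have := ncvg_lin (-1) yy xx; rewrite scaleN1r addrC.
by under eq_fun do rewrite scaleN1r addrC.
Qed.

Lemma ncvg_scale (b : nat -> R) a (x_ : nat -> V) x :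
  b n @[n --> \oo] --> a -> ncvg x_ x -> ncvg (fun n => b n *: x_ n) (a *: x).
Proof.
move=> ba xx; apply: (@ncvg_le _ _ (fun n => `|b n| * nrm (x_ n - x)
    + `|b n - a| * nrm x)) => [n|].
  rewrite [X in nrm X](_ : _ = b n *: (x_ n - x) + (b n - a) *: x).
    by rewrite (le_trans (ler_nrmD _ _))// !nrmZ.
  by rewrite scalerBr scalerBl addrA subrK.
rewrite -[0](addr0 0) -[X in X + _](mulr0 `|a|) -[X in _ + X](mul0r (nrm x)).
apply: cvgD; apply: cvgM => //.
- exact: cvg_norm.
- have : b n - a @[n --> \oo] --> a - a by apply: cvgB => //; exact: cvg_cst.
  by rewrite subrr => /cvg_norm; rewrite normr0.
- exact: cvg_cst.
Qed.

Lemma cvg_dot (x_ y_ : nat -> V) x y : ncvg x_ x -> ncvg y_ y ->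
  d (x_ n) (y_ n) @[n --> \oo] --> d x y.
Proof.
move=> xx yy; apply/subr_cvg0.
apply: norm_cvg0; apply: (@squeeze_cvgr _ _ _ _ (fun=> 0) (fun n =>
  nrm (x_ n - x) * nrm (y_ n - y) + nrm (x_ n - x) * nrm y + nrm x * nrm (y_ n - y))).
- near=> n; rewrite normr_ge0/=.
  rewrite [X in `|X|](_ : _ = d (x_ n - x) (y_ n - y) + d (x_ n - x) y + d x (y_ n - y)).
    by rewrite (le_trans (ler_normD _ _))// lerD ?dot_le_nrm//
      (le_trans (ler_normD _ _))// lerD ?dot_le_nrm.
  by rewrite !dotBr !dotBl; ring.
- exact: cvg_cst.
- rewrite (_ : 0 = 0 * 0 + 0 * nrm y + nrm x * 0); last by rewrite !(mul0r,mulr0,addr0).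
  by apply: cvgD; [apply: cvgD|]; apply: cvgM => //; exact: cvg_cst.
Unshelve. all: by end_near. Qed.

Lemma cvg_nrm (x_ : nat -> V) x : ncvg x_ x -> nrm (x_ n) @[n --> \oo] --> nrm x.
Proof.
move=> xx; apply/subr_cvg0.
apply: norm_cvg0; apply: (@squeeze_cvgr _ _ _ _ (fun=> 0) (fun n => nrm (x_ n - x))) => //.
- by near=> n; rewrite normr_ge0 ler_dist_nrm.
- exact: cvg_cst.
Unshelve. all: by end_near. Qed.

Lemma ncvg_unique (x_ : nat -> V) x y : ncvg x_ x -> ncvg x_ y -> nrm (x - y) = 0.
Proof.
move=> xx xy; have /cvg_nrm := ncvgB xx xy.
under eq_fun do rewrite subrr nrm0.
by move/cvg_lim => <- //; rewrite lim_cst.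
Qed.

Lemma ncvg_null (x_ : nat -> V) x y : nrm (x - y) = 0 -> ncvg x_ x -> ncvg x_ y.
Proof.
move=> xy xx; apply: ncvg_le xx => n.
have -> : x_ n - y = (x_ n - x) + (x - y) by rewrite addrA subrK.
by rewrite (le_trans (ler_nrmD _ _))// xy addr0.
Qed.

(** The Cauchy property is stated as a double limit so that the rules for sums,
    products and comparison of limits apply to it. *)
Definition cauchy2 (r : nat -> nat -> R) : Prop :=
  r p.1 p.2 @[p --> (\oo, \oo)] --> 0.

Definition ncauchy (x_ : nat -> V) := cauchy2 (fun m n => nrm (x_ m - x_ n)).

Definition ncomplete := forall x_ : nat -> V, ncauchy x_ -> exists x, ncvg x_ x.

Lemma cauchy2_le (r r' : nat -> nat -> R) : (forall m n, 0 <= r m n <= r' m n) ->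
  cauchy2 r' -> cauchy2 r.
Proof.
move=> rr' r0; apply: (@squeeze_cvgr _ _ _ _ (fun=> 0) (fun p => r' p.1 p.2)) => //.
  by near=> p.
exact: cvg_cst.
Unshelve. all: by end_near. Qed.

Lemma ncvg_cauchy (x_ : nat -> V) x : ncvg x_ x -> ncauchy x_.
Proof.
move=> xx; apply: (@cauchy2_le _ (fun m n => nrm (x_ m - x) + nrm (x_ n - x))).
  move=> m n; rewrite nrm_ge0/= -[x_ m](subrK x) -addrA (le_trans (ler_nrmD _ _))//.
  by rewrite addrK (nrm_subC x).
rewrite /cauchy2 -[0](addr0 0).
apply: cvgD.
  exact: (@cvg_comp _ _ _ fst (fun m => nrm (x_ m - x)) _ _ _ cvg_fst xx).
exact: (@cvg_comp _ _ _ snd (fun m => nrm (x_ m - x)) _ _ _ cvg_snd xx).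
Qed.

End SemiInnerTheory.

(** * Orthogonal series and shifted problems for closed forms *)

Section Expansions.
Context {R : realType} {V : lmodType R} (d : semi_inner V) (E : nat -> V).
Hypothesis orthE : forall i j, i != j -> d (E i) (E j) = 0.
Implicit Types (f g : V) (b c : nat -> R).

Definition psum c n : V := \sum_(j < n) c j *: E j.

Definition expands c f : Prop := ncvg d (psum c) f.

Lemma dot_psum b c n :
  d (psum b n) (psum c n) = \sum_(j < n) b j * c j * d (E j) (E j).
Proof.
elim: n => [|n IH]; first by rewrite /psum !big_ord0 dot0l.
have orth c' : d (psum c' n) (E n) = 0.
  rewrite /psum (dot_suml d _ _ (fun j => c' j *: E j)) big1// => j _.
  by rewrite dotZl orthE ?mulr0// neq_ltn ltn_ord.
rewrite /psum !big_ord_recr/= -!/(psum _ n) dotDl !dotDr IH.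
by rewrite !dotZl !dotZr (dotC d (E n)) !orth !mulr0 addr0 add0r mulrA.
Qed.

(** Masking the first m coefficients presents a block of the series as a
    partial sum, to which [dot_psum] applies. *)
Lemma psum_tail c m n : (m <= n)%N ->
  psum c n - psum c m = psum (fun j => c j *+ (m <= j)%N) n.
Proof.
move=> mn; rewrite /psum (big_ord_widen n (fun j => c j *: E j) mn).
rewrite [X in _ - X]big_mkcond -sumrB; apply: eq_bigr => j _.
by case: ltnP => jm; rewrite ?subrr ?subr0// ?mulr0n ?scale0r.
Qed.

Lemma psum_lin a b c n :
  psum (fun j => a * b j + c j) n = a *: psum b n + psum c n.
Proof.
rewrite /psum scaler_sumr -big_split; apply: eq_bigr => j _ /=.
by rewrite scalerDl scalerA.
Qed.

Lemma ler_nrm_psum (K : R) b c n : 0 <= K -> (forall j, `|b j| <= K * `|c j|) ->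
  nrm d (psum b n) <= K * nrm d (psum c n).
Proof.
move=> K0 bc; rewrite -(@ler_pXn2r _ 2) ?nnegrE ?mulr_ge0 ?nrm_ge0//.
rewrite exprMn !sqr_nrm !dot_psum mulr_sumr; apply: ler_sum => j _.
rewrite mulrA ler_wpM2r ?dot_ge0// -!expr2 -exprMn -[leLHS]real_normK ?num_real//.
rewrite -[leRHS]real_normK ?num_real// ler_pXn2r ?nnegrE//.
by rewrite normrM (ger0_norm K0).
Qed.

Lemma ler_nrm_psumB (K : R) b c m n : 0 <= K -> (forall j, `|b j| <= K * `|c j|) ->
  nrm d (psum b m - psum b n) <= K * nrm d (psum c m - psum c n).
Proof.
move=> K0 bc; wlog mn : m n / (n <= m)%N.
  by move=> H; have [|/ltnW] := leqP n m; [exact: H|rewrite !(nrm_subC d _ (psum _ n)); exact: H].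
rewrite !psum_tail//; apply: ler_nrm_psum => // j.
by case: (n <= j)%N; rewrite ?mulr1n ?mulr0n ?normr0 ?mulr0.
Qed.

Lemma expands_lin a b c f g : expands b f -> expands c g ->
  expands (fun j => a * b j + c j) (a *: f + g).
Proof.
move=> bf cg; rewrite /expands (_ : psum _ = fun n => a *: psum b n + psum c n).
  exact: ncvg_lin.
by apply/funext => n; rewrite psum_lin.
Qed.

Lemma expandsZ a b f : expands b f -> expands (fun j => a * b j) (a *: f).
Proof.
move=> bf; rewrite -[a *: f]addr0.
rewrite [X in expands X _](_ : _ = fun j => a * b j + 0); last first.
  by apply/funext => j; rewrite addr0.
apply: expands_lin => //; rewrite /expands (_ : psum _ = fun=> 0); first exact: ncvg_cst.
by apply/funext => n; rewrite /psum big1// => j _; rewrite scale0r.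
Qed.

Lemma expandsB b c f g : expands b f -> expands c g ->
  expands (fun j => b j - c j) (f - g).
Proof.
move=> bf cg; rewrite addrC -scaleN1r.
rewrite [X in expands X _](_ : _ = fun j => (-1) * c j + b j).
  exact: expands_lin.
by apply/funext => j; rewrite mulN1r addrC.
Qed.

Lemma expands_single s : expands (fun j => (j == s)%:R) (E s).
Proof.
apply: cvg_near_cst; near=> n.
rewrite [psum _ _](_ : _ = E s) ?subrr ?nrm0//.
rewrite /psum (bigD1 (Ordinal (_ : s < n)%N))//=; first by near: n; exact: nbhs_infty_gt.
move=> sn; rewrite eqxx scale1r big1 ?addr0// => j /negbTE js.
by rewrite -[_ == _]/(j == Ordinal sn) js scale0r.
Unshelve. all: by end_near. Qed.

Lemma parseval b c f g : expands b f -> expands c g ->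
  \sum_(j < n) b j * c j * d (E j) (E j) @[n --> \oo] --> d f g.
Proof. by move=> bf cg; under eq_fun do rewrite -dot_psum; exact: cvg_dot. Qed.

Lemma expands_orth b c f g : expands b f -> expands c g ->
  (forall j, b j * c j = 0) -> d f g = 0.
Proof.
move=> bf cg bc; have := parseval bf cg.
under eq_fun do under eq_bigr do rewrite bc mul0r.
under eq_fun do rewrite big1//.
by move/cvg_lim => <- //; rewrite lim_cst.
Qed.

Lemma expands_coef c f s : expands c f -> d f (E s) = c s * d (E s) (E s).
Proof.
move=> cf; apply/eqP; rewrite -subr_eq0 -dotZl -dotBl; apply/eqP.
apply: expands_orth (expandsB cf (expandsZ (c s) (expands_single s))) (expands_single s) _.
by move=> j; case: eqVneq => [->|_]; rewrite !(mulr1, mulr0, subrr, mul0r).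
Qed.

Lemma ler_nrm_expands (K : R) b c f g : 0 <= K -> expands b f -> expands c g ->
  (forall j, `|b j| <= K * `|c j|) -> nrm d f <= K * nrm d g.
Proof.
move=> K0 /cvg_nrm bf /cvg_nrm cg bc.
apply: (ler_cvg_to bf (cvgM (cvg_cst K) cg)).
by apply: nearW => n; exact: ler_nrm_psum.
Qed.

(** Parseval bounds the blocks of the new series by those of a convergent one,
    so its partial sums are Cauchy. *)
Lemma multiplier (K : R) b c f : ncomplete d -> 0 <= K -> expands c f ->
  (forall j, `|b j| <= K * `|c j|) -> exists g, expands b g.
Proof.
move=> cplt K0 /ncvg_cauchy cf bc; apply: cplt.
apply: (@cauchy2_le _ _ (fun m n => K * nrm d (psum c m - psum c n))).
  by move=> m n; rewrite nrm_ge0/= ler_nrm_psumB.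
by rewrite /cauchy2 -(mulr0 K); apply: cvgM => //; exact: cvg_cst.
Qed.

End Expansions.

(** A symmetric form whose domain is complete: a sequence that converges in
    the ambient norm and is Cauchy for the form converges in the domain.  Only
    the weak consequence on B (x_ n) v is kept, as it is what passes an
    equation to the limit. *)
Record closed_form (R : realType) (V : lmodType R) (d : semi_inner V) := ClosedForm {
  dom : set V ;
  form :> V -> V -> R ;
  dom0 : dom 0 ;
  dom_linear : forall a x y, dom x -> dom y -> dom (a *: x + y) ;
  formC : forall x y, dom x -> dom y -> form x y = form y x ;
  form_linear : forall z a x y, dom x -> dom y -> dom z ->
    form (a *: x + y) z = a * form x z + form y z ;
  form_closed : forall (x_ : nat -> V) x, (forall n, dom (x_ n)) -> ncvg d x_ x ->
    cauchy2 (fun m n => form (x_ m - x_ n) (x_ m - x_ n)) ->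
    dom x /\ forall v, dom v -> form (x_ n) v @[n --> \oo] --> form x v }.

Section ShiftedProblem.
Context {R : realType} {V : lmodType R} {d : semi_inner V} (B : closed_form d).
Variable sigma : R.
Implicit Types (f g w : V).

(** The weak form of A w - sigma w = f for the operator A of the form B.  With
    f = 0 it says that w is an eigenvector for sigma, or null. *)
Definition solves f w : Prop :=
  dom B w /\ forall v, dom B v -> B w v - sigma * d w v = d f v.

Lemma solves_lin a f g w w' : solves f w -> solves g w' ->
  solves (a *: f + g) (a *: w + w').
Proof.
move=> [Dw fw] [Dw' gw']; split; first exact: dom_linear.
move=> v Dv; rewrite form_linear// !dotDl !dotZl -fw// -gw'//; ring.
Qed.

Lemma solves0 : solves 0 0.
Proof.
split; first exact: dom0.
move=> v Dv; have := form_linear 1 (dom0 B) (dom0 B) Dv.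
rewrite scaler0 addr0 mul1r -[LHS]addr0 => /addrI <-.
by rewrite !dot0l mulr0 subr0.
Qed.

Lemma solvesB f g w w' : solves f w -> solves g w' -> solves (f - g) (w - w').
Proof.
by move=> fw gw'; have := solves_lin (-1) gw' fw; rewrite !scaleN1r ![- _ + _]addrC.
Qed.

Lemma solves_sum (f_ w_ : nat -> V) (c : nat -> R) n :
  (forall j, solves (f_ j) (w_ j)) ->
  solves (\sum_(j < n) c j *: f_ j) (\sum_(j < n) c j *: w_ j).
Proof.
move=> fw; elim: n => [|n IH]; first by rewrite !big_ord0; exact: solves0.
by rewrite !big_ord_recr/= addrC [X in solves _ X]addrC; exact: solves_lin.
Qed.

(** The equations themselves compute the energy of w_ m - w_ n as
    sigma |w_ m - w_ n|^2 + <f_ m - f_ n, w_ m - w_ n>, so that convergence of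
    the data and of the solutions in norm already makes the energy Cauchy. *)
Lemma solves_closed (f_ w_ : nat -> V) f w : (forall n, solves (f_ n) (w_ n)) ->
  ncvg d f_ f -> ncvg d w_ w -> solves f w.
Proof.
move=> fw ff ww.
have [||Dw Bw] := @form_closed _ _ _ B w_ w _ ww.
- by move=> n; case: (fw n).
- rewrite /cauchy2.
  have -> : (fun p => B (w_ p.1 - w_ p.2) (w_ p.1 - w_ p.2)) = (fun p : nat * nat =>
    sigma * nrm d (w_ p.1 - w_ p.2) ^+ 2 + d (f_ p.1 - f_ p.2) (w_ p.1 - w_ p.2)).
    apply/funext => -[m n] /=.
    have [Dmn /(_ _ Dmn) <-] := solvesB (fw m) (fw n).
    by rewrite sqr_nrm subrKC.
  have cw := ncvg_cauchy ww; have cf := ncvg_cauchy ff.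
  rewrite -[0](addr0 0); apply: cvgD.
    rewrite -[X in _ --> X](mulr0 sigma); apply: cvgM; first exact: cvg_cst.
    by rewrite -[X in _ --> X](mulr0 0); exact: cvgM.
  apply: norm_cvg0.
  apply: (@squeeze_cvgr _ _ _ _ (fun=> 0) (fun p =>
    nrm d (f_ p.1 - f_ p.2) * nrm d (w_ p.1 - w_ p.2))).
  + by near=> p; rewrite normr_ge0 dot_le_nrm.
  + exact: cvg_cst.
  + by rewrite -[X in _ --> X](mulr0 0); exact: cvgM.
split => // v Dv.
have L : B (w_ n) v - sigma * d (w_ n) v @[n --> \oo] --> B w v - sigma * d w v.
  apply: cvgB; first exact: Bw.
  by apply: cvgM; [exact: cvg_cst|exact: (cvg_dot ww (ncvg_cst d v))].
have L' : d (f_ n) v @[n --> \oo] --> d f v.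
  exact: (cvg_dot ff (ncvg_cst d v)).
have E : (fun n => B (w_ n) v - sigma * d (w_ n) v) = (fun n => d (f_ n) v).
  by apply/funext => n; have [_ ->] := fw n.
by rewrite E in L; rewrite -(cvg_lim _ L)// -(cvg_lim _ L').
Unshelve. all: by end_near. Qed.

Hypothesis injective : forall w, solves 0 w -> nrm d w = 0.

(** Solving the shifted problem multiplies coefficients by kappa.  Multiplying
    them produces some w' whose partial sums solve the problem with the partial
    sums of f; by [solves_closed] w' is a solution with datum f, and w - w' is
    null by injectivity. *)
Lemma solves_expands (E : nat -> V) (kappa : nat -> R) (K : R) c f w :
    (forall i j, i != j -> d (E i) (E j) = 0) -> ncomplete d -> 0 <= K ->
    (forall j, `|kappa j| <= K) -> (forall j, solves (E j) (kappa j *: E j)) ->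
  expands d E c f -> solves f w -> expands d E (fun j => c j * kappa j) w.
Proof.
move=> orthE cplt K0 kK sE cf fw.
have [|w' cw'] := multiplier (b := fun j => c j * kappa j) orthE cplt K0 cf.
  by move=> j; rewrite normrM mulrC ler_wpM2r.
have fw' : solves f w'.
  apply: (solves_closed _ cf cw') => n.
  rewrite /psum; under [X in solves _ X]eq_bigr do rewrite -scalerA.
  exact: (solves_sum (w_ := fun j => kappa j *: E j)).
apply: ncvg_null cw'; apply: injective.
by rewrite -(subrr f); exact: solvesB.
Qed.

End ShiftedProblem.

(** * The rescaled iterates *)

Section Directions.
Context {R : realType} {V : lmodType R} (d : semi_inner V).
Implicit Types (x y e u : V).

Definition direction x : V := (nrm d x)^-1 *: x.

(** One term |x - y| / |y| comes from replacing x by y with the normalization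
    of y, another from replacing the normalization of x by that of y. *)
Lemma ler_direction x y : 0 < nrm d y ->
  nrm d (direction x - direction y) <= 2 / nrm d y * nrm d (x - y).
Proof.
move=> y0.
have -> : direction x - direction y =
    (nrm d y)^-1 *: (x - y) + ((nrm d x)^-1 - (nrm d y)^-1) *: x.
  by rewrite /direction scalerBr scalerBl [RHS]addrC addrA subrK.
rewrite (le_trans (ler_nrmD _ _ _))// !nrmZ gtr0_norm ?invr_gt0//.
have -> : 2 / nrm d y * nrm d (x - y) =
    (nrm d y)^-1 * nrm d (x - y) + (nrm d y)^-1 * nrm d (x - y) by ring.
rewrite lerD2l; have [->|x0] := eqVneq (nrm d x) 0.
  by rewrite mulr0 mulr_ge0 ?invr_ge0 ?nrm_ge0.
have {}x0 : 0 < nrm d x by rewrite lt0r x0 nrm_ge0.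
rewrite -[X in _ * X <= _]gtr0_norm// -normrM.
have -> : ((nrm d x)^-1 - (nrm d y)^-1) * nrm d x =
    (nrm d y)^-1 * (nrm d y - nrm d x) by field; rewrite !gt_eqF.
by rewrite normrM gtr0_norm ?invr_gt0// ler_pM2l ?invr_gt0// nrm_subC ler_dist_nrm.
Qed.

(** The projection of u on the line of x is (<u, x> / <x, x>) x, a continuous
    function of x away from 0. *)
Lemma ncvg_projection u e (x_ : nat -> V) : ncvg d x_ e -> d e e != 0 ->
  d u e = d e e -> ncvg d (fun n => d u (direction (x_ n)) *: direction (x_ n)) e.
Proof.
move=> xe e0 ue; rewrite -[X in ncvg _ _ X]scale1r -(divff e0) -{1}ue.
have -> : (fun n => d u (direction (x_ n)) *: direction (x_ n)) =
    (fun n => (d u (x_ n) / d (x_ n) (x_ n)) *: x_ n).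
  apply/funext => n; rewrite /direction dotZr scalerA; congr (_ *: _).
  by rewrite -sqr_nrm expr2 invfM; ring.
apply: ncvg_scale => //; apply: cvgM; first exact: (cvg_dot (ncvg_cst d u) xe).
by apply: cvgV => //; exact: (cvg_dot xe xe).
Qed.

End Directions.

(** In this part x_ n is the n-th iterate rescaled so that its component along
    E s does not depend on n.  The other indices with |rho j| = 1 can only come
    from an eigenvalue at the same distance from the shift, on the other side:
    psi_ n leaves them out, whereas the remainder x_ n - E s contains them. *)
Section NormalizedIteration.
Context {R : realType} {V : lmodType R} (d : semi_inner V) (E : nat -> V).
Hypothesis orthE : forall i j, i != j -> d (E i) (E j) = 0.
Variables (u : V) (rho : nat -> R) (s : nat) (x_ psi_ : nat -> V).
Hypothesis uE : expands d E (fun=> 1) u.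
Hypothesis rho_le1 : forall j, `|rho j| <= 1.
Hypothesis rho_s : rho s = 1.
Hypothesis xE : forall n, expands d E (fun j => rho j ^+ n) (x_ n).
Hypothesis psiE : forall n,
  expands d E (fun j => if `|rho j| < 1 then rho j ^+ n else 0) (psi_ n).
Hypothesis Es_neq0 : d (E s) (E s) != 0.

Lemma nrm_Es_gt0 : 0 < nrm d (E s).
Proof. by rewrite sqrtr_gt0 lt0r Es_neq0 dot_ge0. Qed.

Lemma ler_psi (q : R) n : 0 <= q -> (forall j, `|rho j| < 1 -> `|rho j| <= q) ->
  nrm d (psi_ n) <= q ^+ n * nrm d u.
Proof.
move=> q0 rq; apply: (ler_nrm_expands orthE _ (psiE n) uE); first exact: exprn_ge0.
move=> j; rewrite normr1 mulr1; case: ifPn => [r1|_].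
  by rewrite normrX lerXn2r ?nnegrE ?rq.
by rewrite normr0 exprn_ge0.
Qed.

(** When another index has |rho j| = 1 this holds with q = 1 only. *)
Lemma ler_remainder (q : R) n : 0 <= q -> (forall j, j != s -> `|rho j| <= q) ->
  nrm d (x_ n - E s) <= q ^+ n * nrm d u.
Proof.
move=> q0 rq; apply: (ler_nrm_expands orthE _ (expandsB (xE n) (expands_single d E s)) uE).
  exact: exprn_ge0.
move=> j; rewrite normr1 mulr1; case: eqVneq => [->|js].
  by rewrite rho_s expr1n subrr normr0 exprn_ge0.
by rewrite subr0 normrX lerXn2r ?nnegrE ?rq.
Qed.

Lemma remainder_orth n : d (x_ n - E s) (E s) = 0.
Proof.
by rewrite dotBl (expands_coef orthE s (xE n)) rho_s expr1n mul1r subrr.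
Qed.

Lemma ler_Es_x n : nrm d (E s) <= nrm d (x_ n).
Proof.
rewrite -[leRHS]mul1r.
apply: (ler_nrm_expands orthE ler01 (expands_single d E s) (xE n)) => j.
by case: eqVneq => [->|_]; rewrite ?rho_s ?expr1n ?normr1 ?mul1r// normr0.
Qed.

(** The part y of x_ n carried by the indices with |rho j| = 1 has a norm
    independent of n, since its coefficients only change sign; the rest is
    psi_ n, which tends to 0. *)
Lemma cvg_nrm_x (q : R) : 0 < q < 1 -> (forall j, `|rho j| < 1 -> `|rho j| <= q) ->
  exists2 L : R, 0 < L & nrm d (x_ n) @[n --> \oo] --> L.
Proof.
move=> /andP[q0 q1] rq.
pose y n := x_ n - psi_ n.
have yE n : expands d E (fun j => if `|rho j| < 1 then 0 else rho j ^+ n) (y n).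
  rewrite [X in expands _ _ X](_ : _ = fun j => rho j ^+ n -
    (if `|rho j| < 1 then rho j ^+ n else 0)); first exact: expandsB.
  by apply/funext => j; case: ifP => _; rewrite ?subrr ?subr0.
have rho1 j n : ~~ (`|rho j| < 1) -> `|rho j ^+ n| = 1.
  move=> r1; suff r : `|rho j| = 1 by rewrite normrX r expr1n.
  by apply/eqP; rewrite eq_le rho_le1 leNgt.
have le_y m n : nrm d (y m) <= nrm d (y n).
  rewrite -[leRHS]mul1r; apply: (ler_nrm_expands orthE ler01 (yE m) (yE n)) => j.
  by case: ifPn => r1; rewrite ?normr0 ?rho1 ?mulr0 ?mulr1.
exists (nrm d (y 0%N)).
  apply: (lt_le_trans nrm_Es_gt0); rewrite -[leRHS]mul1r.
  apply: (ler_nrm_expands orthE ler01 (expands_single d E s) (yE 0%N)) => j.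
  case: eqVneq => [->|_]; last by rewrite normr0 mulr_ge0.
  by rewrite rho_s normr1 ltxx expr0 normr1 mulr1.
apply/subr_cvg0; apply: norm_cvg0.
apply: (@squeeze_cvgr _ _ _ _ (fun=> 0) (fun n => q ^+ n * nrm d u)).
- apply: nearW => n; rewrite normr_ge0/=.
  have -> : nrm d (y 0%N) = nrm d (y n) by apply/le_anti; rewrite !le_y.
  rewrite (le_trans (ler_dist_nrm _ _ _))// /y opprB subrKC.
  exact: ler_psi (ltW q0) rq.
- exact: cvg_cst.
- rewrite -[X in _ --> X](mul0r (nrm d u)); apply: cvgM; last exact: cvg_cst.
  by apply: cvg_expr; rewrite ger0_norm// ltW.
Qed.

Lemma cvg_nrm_ratio (q : R) : 0 < q < 1 -> (forall j, `|rho j| < 1 -> `|rho j| <= q) ->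
  nrm d (x_ n) / nrm d (x_ n.+1) @[n --> \oo] --> (1 : R).
Proof.
move=> q01 rq; have [L L0 xL] := cvg_nrm_x q01 rq.
have Ln0 : L != 0 by rewrite gt_eqF.
rewrite -[X in _ --> X](divff Ln0).
apply: cvgM => //; apply: cvgV => //.
by rewrite (cvg_shiftS (fun n => nrm d (x_ n))).
Qed.

Lemma ncvg_x (q : R) : 0 < q < 1 -> (forall j, j != s -> `|rho j| <= q) ->
  ncvg d x_ (E s).
Proof.
move=> /andP[q0 q1] rq; apply: (@ncvg_le _ _ _ _ _ (fun n => q ^+ n * nrm d u)).
  by move=> n; exact: ler_remainder (ltW q0) rq.
rewrite -[X in _ --> X](mul0r (nrm d u)); apply: cvgM; last exact: cvg_cst.
by apply: cvg_expr; rewrite ger0_norm// ltW.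
Qed.

(** With x_ n = E s + a, x_ n.+1 = E s + b and a, b orthogonal to E s, the
    numerator <x_ n, x_ n.+1> - |x_ n.+1|^2 is <a, b> - |b|^2, which is
    quadratic in the remainders. *)
Lemma ler_consecutive (q : R) n : 0 < q -> (forall j, j != s -> `|rho j| <= q) ->
  `|d (x_ n) (x_ n.+1) / d (x_ n.+1) (x_ n.+1) - 1| <=
    (1 + q^-1) * (nrm d u / nrm d (E s)) ^+ 2 * q ^+ (2 * n.+1).
Proof.
move=> q0 rq.
have Es0 := nrm_Es_gt0; have x0 := lt_le_trans Es0 (ler_Es_x n.+1).
have u0 := nrm_ge0 d u.
rewrite -sqr_nrm.
rewrite (_ : _ - 1 = (d (x_ n) (x_ n.+1) - nrm d (x_ n.+1) ^+ 2) / nrm d (x_ n.+1) ^+ 2);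
  last by rewrite mulrBl divff// expf_eq0 gt_eqF.
rewrite normrM normfV [X in _ / X]ger0_norm ?exprn_ge0 ?nrm_ge0//.
rewrite ler_pdivrMr ?exprn_gt0//.
apply: (@le_trans _ _ ((1 + q^-1) * (nrm d u / nrm d (E s)) ^+ 2 * q ^+ (2 * n.+1)
    * nrm d (E s) ^+ 2)); last first.
  rewrite ler_wpM2l// ?lerXn2r ?nnegrE ?nrm_ge0 ?ler_Es_x//.
  by rewrite !mulr_ge0// ?exprn_ge0// ?addr_ge0 ?divr_ge0 ?invr_ge0 ?nrm_ge0// ltW.
set a := x_ n - E s; set b := x_ n.+1 - E s.
have xn : x_ n = E s + a by rewrite /a subrKC.
have xn1 : x_ n.+1 = E s + b by rewrite /b subrKC.
have aE : d a (E s) = 0 by exact: remainder_orth.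
have bE : d b (E s) = 0 by exact: remainder_orth.
have ha : nrm d a <= q ^+ n * nrm d u by exact: ler_remainder (ltW q0) rq.
have hb : nrm d b <= q ^+ n.+1 * nrm d u by exact: ler_remainder (ltW q0) rq.
clearbody a b.
have -> : d (x_ n) (x_ n.+1) - nrm d (x_ n.+1) ^+ 2 = d a b - nrm d b ^+ 2.
  rewrite !sqr_nrm xn xn1 !dotDl !dotDr aE (dotC d (E s) b) bE; ring.
apply: (@le_trans _ _ (q ^+ n * nrm d u * (q ^+ n.+1 * nrm d u)
    + (q ^+ n.+1 * nrm d u) ^+ 2)); last first.
  rewrite le_eqVlt; apply/orP; left; apply/eqP.
  by rewrite mulnC exprM !exprS; field; rewrite !gt_eqF.
rewrite (le_trans (ler_normB _ _))// lerD//.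
  by rewrite (le_trans (dot_le_nrm _ _ _))// ler_pM// nrm_ge0.
by rewrite ger0_norm ?exprn_ge0 ?nrm_ge0// lerXn2r ?nnegrE ?nrm_ge0// (le_trans (nrm_ge0 _ _) hb).
Qed.

End NormalizedIteration.

(** * Completeness of the space of square-integrable functions *)

Section Sequences.
Context {R : realType}.

Lemma limn_einf_le (a : (\bar R)^nat) (c : \bar R) :
  (\forall n \near \oo, (a n <= c)%E) -> (limn_einf a <= c)%E.
Proof.
move=> ac; rewrite limn_einf_lim; apply: lime_le; first exact: is_cvg_einfs.
near=> n; apply: (@le_trans _ _ (a n)); last by near: n.
by apply: ereal_inf_lbound; exists n => /=.
Unshelve. all: by end_near. Qed.

(** The indices are made monotone by taking maxima of the moduli of the Cauchy
    property, and unbounded by adding i. *)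
Lemma rapid_subsequence (r : nat -> nat -> R) (b : nat -> R) :
  cauchy2 r -> (forall i, 0 < b i) ->
  exists k : nat -> nat, [/\ {homo k : i j / (i <= j)%N}, forall i, (i <= k i)%N &
    forall i m n, (k i <= m)%N -> (k i <= n)%N -> `|r m n| < b i].
Proof.
move=> r0 b0.
have /choice[K KP] : forall i, exists K, forall m n, (K <= m)%N -> (K <= n)%N -> `|r m n| < b i.
  move=> i; have /cvgr0Pnorm_lt/(_ _ (b0 i))[[A B] /= [[a _ aA] [b' _ bB]] AB] := r0.
  exists (maxn a b') => m n; rewrite !geq_max => /andP[am _] /andP[_ bn].
  by apply: (AB (m, n)); split; [exact: aA|exact: bB].
exists (fun i => i + \max_(j < i.+1) K j)%N; split.
- move=> i j ij; rewrite leq_add//; apply/bigmax_leqP => l _.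
  have lj : (l < j.+1)%N by rewrite (leq_trans (ltn_ord l)).
  exact: (@leq_bigmax _ (fun l : 'I_j.+1 => K l) (Ordinal lj)).
- by move=> i; rewrite leq_addr.
- have Kk i : (K i <= i + \max_(j < i.+1) K j)%N.
    by rewrite (leq_trans (@leq_bigmax _ (fun l : 'I_i.+1 => K l) ord_max)) ?leq_addl.
  by move=> i m n im iN; apply: KP; rewrite (leq_trans (Kk i)).
Qed.

Lemma cvg_geometric_steps (a : nat -> R) (C : R) :
  (forall i, `|a i.+1 - a i| <= C * 2^-1 ^+ i) -> cvgn a.
Proof.
move=> aC; have C0 : 0 <= C.
  by have := le_trans (normr_ge0 _) (aC 0%N); rewrite expr0 mulr1.
have /(@is_cvg_geometric_series R C) : `|2^-1 : R| < 1.
  by rewrite ger0_norm// invf_lt1// ltr1n.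
have ta : cvgn (series (geometric C 2^-1)) -> cvgn (series (telescope a)).
  move=> gC; apply: normed_cvg; apply: series_le_cvg gC => n.
  - exact: normr_ge0.
  - by rewrite /geometric/= mulr_ge0// exprn_ge0.
  - exact: aC.
move=> /ta /cvg_ex[l al]; apply/cvg_ex; exists (a 0%N + l).
rewrite [X in X @ _ --> _](_ : _ = fun n => a 0%N + series (telescope a) n).
  by apply: cvgD => //; exact: cvg_cst.
by apply/funext => n; exact: eq_sum_telescope.
Qed.

End Sequences.

Lemma le1_2E (R : realType) : (1 <= (2 : R)%:E)%E.
Proof. by rewrite lee_fin ler1n. Qed.

Section SquareIntegrable.
Context {disp : measure_display} {T : measurableType disp} {R : realType}.
Variable mu : {measure set T -> \bar R}.

Definition L2fun := LfunType mu (le1_2E R).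
Implicit Types f g : L2fun.

Lemma L2funP f : (f : T -> R) \in Lfun mu 2%:E.
Proof. exact: LfunP. Qed.

Lemma integrable_mulL2 f g : mu.-integrable setT (EFin \o (fun x => f x * g x)).
Proof. by apply/Lfun1_integrable; apply: Lfun2_mul_Lfun1; exact: L2funP. Qed.

Definition L2dot f g : R := \int[mu]_x (f x * g x).

Lemma L2dotC f g : L2dot f g = L2dot g f.
Proof. by apply: eq_Rintegral => x _; rewrite mulrC. Qed.

Lemma L2dot_linear h a f g : L2dot (a *: f + g) h = a * L2dot f h + L2dot g h.
Proof.
rewrite /L2dot -RintegralZl//; last exact: integrable_mulL2.
rewrite -RintegralD//=; last exact: integrable_mulL2.
  by apply: eq_Rintegral => x _ /=; rewrite mulrDl mulrA.
have := integrable_mulL2 (a *: f) h.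
by apply: eq_integrable => // x _ /=; rewrite mulrA.
Qed.

Lemma L2dot_ge0 f : 0 <= L2dot f f.
Proof. by apply: Rintegral_ge0 => x _; rewrite -expr2 sqr_ge0. Qed.

Definition L2inner : semi_inner L2fun := SemiInner L2dotC L2dot_linear L2dot_ge0.

Lemma integral_sqr f : (\int[mu]_x (f x ^+ 2)%:E)%E = (nrm L2inner f ^+ 2)%:E.
Proof.
rewrite sqr_nrm/= /L2dot /Rintegral fineK.
  by apply: eq_integral => x _; rewrite expr2.
by apply: integrable_fin_num => //; exact: integrable_mulL2.
Qed.

Lemma nrmL2 f : nrm L2inner f = fine (Lnorm mu 2%:E (EFin \o f)).
Proof.
rewrite unlock (_ : (\int[mu]_x _)%E = (nrm L2inner f ^+ 2)%:E); last first.
  rewrite -integral_sqr; apply: eq_integral => x _ /=.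
  by rewrite powR_mulrn// real_normK ?num_real.
by rewrite /= powR12_sqrt ?sqr_ge0// sqrtr_sqr ger0_norm ?nrm_ge0.
Qed.

Lemma Lfun2_integral (f : T -> R) : measurable_fun setT f ->
  (\int[mu]_x (f x ^+ 2)%:E < +oo)%E -> f \in Lfun mu 2%:E.
Proof.
move=> mf fy; rewrite inE; apply/andP; split; rewrite inE//=.
rewrite /finite_norm unlock poweR_lty// (le_lt_trans _ fy)//.
rewrite le_eqVlt; apply/orP; left; apply/eqP; apply: eq_integral => x _ /=.
by rewrite powR_mulrn// real_normK ?num_real.
Qed.

(** Riesz-Fischer.  Along a subsequence v with |v_(i+1) - v_i| < 4^-(i+1), the
    series h = sum_i 4^i (v_(i+1) - v_i)^2 has a finite integral, hence is
    finite almost everywhere; there |v_(i+1) - v_i| <= 2^-i (1 + h), so v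
    converges pointwise.  By Fatou's lemma the distance from the pointwise limit
    to x_ n is at most the limit inferior of the distances from v_i to x_ n. *)
Lemma L2_complete : ncomplete L2inner.
Proof.
move=> x_ cx.
pose b i : R := 4^-1 ^+ i.+1.
have b0 i : 0 < b i by rewrite exprn_gt0.
have [k [k_homo k_ge kb]] := rapid_subsequence cx b0.
pose v i := x_ (k i).
pose w i x : \bar R := (4 ^+ i * (v i.+1 x - v i x) ^+ 2)%:E.
have mw i : measurable_fun setT (w i).
  apply/measurable_EFinP; apply: measurable_funM => //; apply: measurable_funX.
  exact: measurable_funB.
have w0 i x : (0 <= w i x)%E by rewrite lee_fin mulr_ge0 ?sqr_ge0 ?exprn_ge0.
have iw : (\int[mu]_x (\sum_(i <oo) w i x) < +oo)%E.
  rewrite integral_nneseries//.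
  apply: (@le_lt_trans _ _ 1%:E); last by rewrite ltry.
  rewrite (le_trans _ (@epsilon_trick0 R 1 xpredT _))//.
  apply: lee_nneseries => [i _ _|i _]; first exact: integral_ge0.
  under eq_integral do rewrite /w EFinM.
  rewrite ge0_integralZl//; last 2 first.
  - by apply/measurable_EFinP; apply: measurable_funX; exact: measurable_funB.
  - by move=> x _; rewrite lee_fin sqr_ge0.
  rewrite (integral_sqr (v i.+1 - v i)) -EFinM lee_fin.
  apply: (@le_trans _ _ (4 ^+ i * b i ^+ 2)).
    rewrite ler_wpM2l ?exprn_ge0// lerXn2r ?nnegrE ?nrm_ge0 ?ltW//.
    by rewrite -[ltLHS]ger0_norm ?nrm_ge0// kb// k_homo.
  rewrite natrX div1r -exprVn /b (exprS _ i) (exprS _ i).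
  have : 4 ^+ i * 4^-1 ^+ i = 1 :> R by rewrite -exprMn divff ?expr1n ?pnatr_eq0.
  have : 4^-1 ^+ i <= 2^-1 ^+ i :> R.
    by rewrite lerXn2r ?nnegrE// lef_pV2 ?posrE// ler_nat.
  set p := 4 ^+ i; set q := 4^-1 ^+ i; set r := 2^-1 ^+ i => qr pq.
  rewrite exprMn expr2 [X in X <= _](_ : _ = (p * q) * q * (4^-1 ^+ 2)); last by ring.
  have q0 : 0 <= q by rewrite exprn_ge0.
  by rewrite pq; lra.
have vcvg : {ae mu, forall x, cvgn (v ^~ x)}.
  have : mu.-integrable setT (fun x => \sum_(i <oo) w i x)%E.
    apply/integrableP; split.
      by apply: (ge0_emeasurable_sum (P := xpredT)) => // i _; exact: mw.
    under eq_integral do rewrite gee0_abs ?nneseries_ge0//.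
    exact: iw.
  move=> /integrable_ae - /(_ measurableT); apply: filterS => x /(_ I) wx.
  set H := fine (\sum_(i <oo) w i x)%E.
  have wH i : w i x = (4 ^+ i * (v i.+1 x - v i x) ^+ 2)%:E by [].
  have le_H i : 4 ^+ i * (v i.+1 x - v i x) ^+ 2 <= H.
    rewrite -lee_fin /H fineK// -wH.
    apply: (@le_trans _ _ (\sum_(0 <= j < i.+1) w j x)%E).
      by rewrite big_nat_recr//= leeDr// sume_ge0.
    by apply: nneseries_lim_ge => j _ _.
  have H0 : 0 <= H by rewrite (le_trans _ (le_H 0%N))// mulr_ge0 ?sqr_ge0 ?exprn_ge0.
  apply: (@cvg_geometric_steps _ _ (1 + H)) => i.
  rewrite exprVn ler_pdivlMr ?exprn_gt0// -[X in X <= _]ger0_norm; last first.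
    by rewrite mulr_ge0 ?exprn_ge0.
  rewrite -ler_sqr ?nnegrE ?addr_ge0//.
  rewrite normrM normr_id (ger0_norm (exprn_ge0 _ _))// exprMn real_normK ?num_real//.
  rewrite -exprM mulnC exprM -natrX mulrC (le_trans (le_H i))//.
  nra.
(* The upper limit is measurable on the whole space, so that the exceptional
   null set need not be removed. *)
pose f x := fine (limn_esup (fun i => (v i x)%:E)).
have mf : measurable_fun setT f.
  apply: measurableT_comp => //; apply: measurable_fun_limn_esup => i.
  exact/measurable_EFinP.
have vf : {ae mu, forall x, v ^~ x @ \oo --> f x}.
  apply: filterS vcvg => x vx; suff -> : f x = limn (v ^~ x) by [].
  have vE : (v i x)%:E @[i --> \oo] --> (limn (v ^~ x))%:E.
    by apply: cvg_EFin => //; exact: nearW.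
  by rewrite /f; have [_ ->] := cvg_limn_einf_sup vE.
have fatou_f n (c : R) : (\forall m \near \oo, nrm L2inner (x_ m - x_ n) <= c) ->
    (\int[mu]_x ((f x - x_ n x) ^+ 2)%:E <= (c ^+ 2)%:E)%E.
  move=> xc.
  pose g i x : \bar R := ((v i x - x_ n x) ^+ 2)%:E.
  have mg i : measurable_fun setT (g i).
    by apply/measurable_EFinP; apply: measurable_funX; exact: measurable_funB.
  have g0 i x : (0 <= g i x)%E by rewrite lee_fin sqr_ge0.
  apply: (@le_trans _ _ (\int[mu]_x limn_einf (g ^~ x))%E).
    apply: ae_ge0_le_integral => //.
    - by move=> x _; rewrite lee_fin sqr_ge0.
    - by apply/measurable_EFinP; apply: measurable_funX; exact: measurable_funB.
    - move=> x _; rewrite limn_einf_lim; apply: lime_ge; first exact: is_cvg_einfs.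
      by apply: nearW => i; apply: le_ereal_inf_tmp => _ [j _ <-].
    - rewrite (_ : (fun x => _) = fun x => - limn_esup (fun i => - g i x))%E; last first.
        by apply/funext => x; rewrite -limn_einfN; congr limn_einf;
          apply/funext => i; exact/esym/oppeK.
      by apply: measurableT_comp => //; apply: measurable_fun_limn_esup => i;
        exact: measurableT_comp.
    apply: filterS vf => x vx _.
    suff gx : g ^~ x @ \oo --> ((f x - x_ n x) ^+ 2)%:E.
      by have [-> _] := cvg_limn_einf_sup gx.
    apply: cvg_EFin; first exact: nearW.
    by apply: cvgM; apply: cvgB => //; exact: cvg_cst.
  apply: (le_trans (fatou _ _ _ _)) => //.
  apply: limn_einf_le.
  case: xc => K _ xc; exists K => // i /= Ki.
  have vc : nrm L2inner (v i - x_ n) <= c by apply: xc; rewrite /= (leq_trans Ki).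
  rewrite (integral_sqr (v i - x_ n)) lee_fin lerXn2r ?nnegrE ?nrm_ge0//.
  exact: le_trans (nrm_ge0 _ _) vc.
have cauchy_near (eps : R) : 0 < eps -> \forall n \near \oo,
    \forall m \near \oo, nrm L2inner (x_ m - x_ n) <= eps.
  move=> eps0; have /cvgr0Pnorm_lt/(_ _ eps0)[[A B] /= [[a _ aA] [c _ cB]] AB] := cx.
  exists c => // n cn; exists a => // m am.
  have := AB (m, n) (conj (aA _ am) (cB _ cn)); rewrite /= ger0_norm ?nrm_ge0//.
  exact: ltW.
have fL2 : f \in Lfun mu 2%:E.
  have [n _ /(_ _ (leqnn n)) xn] := cauchy_near 1 ltr01.
  have fxn : (f \- x_ n)%R \in Lfun mu 2%:E.
    apply: Lfun2_integral; first exact: measurable_funB.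
    by rewrite (le_lt_trans (fatou_f _ _ xn))// ltry.
  have fE : f = (x_ n : T -> R) + (f \- x_ n)%R by apply/funext => x; exact/esym/subrKC.
  by rewrite fE; exact: (L2funP (x_ n + Lfun_Sub (le1_2E R) fxn)).
exists (Lfun_Sub (le1_2E R) fL2); apply/cvgr0Pnorm_le => eps eps0.
apply: filterS (cauchy_near eps eps0) => n xn.
rewrite ger0_norm ?nrm_ge0// nrm_subC -(@ler_pXn2r _ 2) ?nnegrE ?nrm_ge0 ?(ltW eps0)//.
by rewrite -lee_fin -integral_sqr fatou_f.
Qed.

End SquareIntegrable.

(** * The energy form of an abstract gradient *)

(** T v g stands for: v is a test function and g is its gradient.  That
    partial derivatives of test functions are test functions ([T_partial]) is
    the property behind the uniqueness of gradients. *)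
Section GradientForm.
Context {R : realType} {V : lmodType R} (d : semi_inner V) {I : finType}.
Variable T : V -> (I -> V) -> Prop.
Hypothesis T0 : T 0 (fun=> 0).
Hypothesis T_linear : forall (a : R) v w g h, T v g -> T w h ->
  T (a *: v + w) (fun i => a *: g i + h i).
Hypothesis T_partial : forall v g i, T v g -> exists h, T (g i) h.
Hypothesis cplt : ncomplete d.
Implicit Types (x y v w : V) (G H g h : I -> V).

Definition weak_partials x G : Prop :=
  forall v g i, T v g -> d x (g i) = - d (G i) v.

Definition approximable x G : Prop := exists (v_ : nat -> V) (g_ : nat -> I -> V),
  [/\ forall k, T (v_ k) (g_ k), ncvg d v_ x &
      forall i, ncvg d (fun k => g_ k i) (G i)].

Definition has_gradient x G : Prop := weak_partials x G /\ approximable x G.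

Lemma has_gradient0 : has_gradient 0 (fun=> 0).
Proof.
split; first by move=> v g i _; rewrite !dot0l oppr0.
by exists (fun=> 0), (fun _ _ => 0); split=> // *; exact: ncvg_cst.
Qed.

Lemma has_gradient_linear a x y G H : has_gradient x G -> has_gradient y H ->
  has_gradient (a *: x + y) (fun i => a *: G i + H i).
Proof.
move=> [wx [v_ [g_ [Tv vx gG]]]] [wy [w_ [h_ [Tw wy' hH]]]]; split.
  by move=> v g i Tvg; rewrite !dotDl !dotZl (wx _ _ _ Tvg) (wy _ _ _ Tvg); ring.
exists (fun k => a *: v_ k + w_ k), (fun k i => a *: g_ k i + h_ k i); split.
- by move=> k; exact: T_linear.
- exact: ncvg_lin.
- by move=> i; exact: ncvg_lin.
Qed.

Lemma has_gradientB x y G H : has_gradient x G -> has_gradient y H ->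
  has_gradient (x - y) (fun i => G i - H i).
Proof.
move=> xG yH; have := has_gradient_linear (-1) yH xG.
rewrite scaleN1r addrC; congr has_gradient.
by apply/funext => i; rewrite scaleN1r addrC.
Qed.

(** H i is a limit of partial derivatives g_k i of test functions.  These are
    test functions, so <H i, g_k i> = - <y, partial i (g_k i)> = 0 by
    the definition of weak derivatives, and <H i, H i> = 0 in the limit. *)
Lemma gradient_of_null y H i : nrm d y = 0 -> has_gradient y H -> nrm d (H i) = 0.
Proof.
move=> y0 [wy [v_ [g_ [Tv _ gH]]]].
have H0 : d (H i) (H i) = 0.
  have HH := cvg_dot (ncvg_cst d (H i)) (gH i).
  rewrite -(cvg_lim _ HH)// (_ : (fun n => _) = fun=> 0) ?lim_cst//.
  apply/funext => k; have [h Th] := T_partial i (Tv k).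
  by apply/eqP; rewrite -oppr_eq0 -(wy _ _ _ Th) nrm0_dotl.
by rewrite /nrm H0 sqrtr0.
Qed.

Lemma gradient_unique x G H i : has_gradient x G -> has_gradient x H ->
  nrm d (G i - H i) = 0.
Proof.
move=> xG xH; apply: gradient_of_null (has_gradientB xG xH).
by rewrite subrr nrm0.
Qed.

(** Weak derivatives pass to the limit by continuity of the inner product;
    approximation by test functions does so by a diagonal choice. *)
Lemma has_gradient_closed (x_ : nat -> V) (G_ : nat -> I -> V) x G :
  (forall n, has_gradient (x_ n) (G_ n)) -> ncvg d x_ x ->
  (forall i, ncvg d (fun n => G_ n i) (G i)) -> has_gradient x G.
Proof.
move=> xG xx GG; split.
  move=> v g i Tvg; have /cvgN L := cvg_dot (GG i) (ncvg_cst d v).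
  have L' := cvg_dot xx (ncvg_cst d (g i)).
  rewrite -(cvg_lim _ L')// -(cvg_lim _ L)// (_ : (fun n => d (x_ n) (g i)) =
    (fun n => - d (G_ n i) v))//.
  by apply/funext => n; have [/(_ _ _ _ Tvg)] := xG n.
have /choice[vg vgP] n : exists p : V * (I -> V), [/\ T p.1 p.2,
    nrm d (p.1 - x_ n) <= n.+1%:R^-1 & forall i, nrm d (p.2 i - G_ n i) <= n.+1%:R^-1].
  have [_ [v_ [g_ [Tv vx gG]]]] := xG n.
  have e0 : 0 < n.+1%:R^-1 :> R by rewrite invr_gt0.
  have : \forall k \near \oo, nrm d (v_ k - x_ n) <= n.+1%:R^-1 /\
      forall i, nrm d (g_ k i - G_ n i) <= n.+1%:R^-1.
    near=> k; split.
      rewrite -[leLHS]ger0_norm ?nrm_ge0//; near: k.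
      by move/cvgr0Pnorm_le : vx; apply.
    move=> i; rewrite -[leLHS]ger0_norm ?nrm_ge0//; move: i; near: k.
    apply: filter_forall => i.
    by have /cvgr0Pnorm_le := gG i; apply.
  by case=> k _ /(_ k (leqnn k)) [vk gk]; exists (v_ k, g_ k); split=> //; exact: Tv.
have inv0 : (n.+1%:R^-1 : R) @[n --> \oo] --> 0 by exact: cvg_harmonic.
exists (fun n => (vg n).1), (fun n => (vg n).2); split.
- by move=> n; have [] := vgP n.
- apply: (@ncvg_le _ _ _ _ _ (fun n => n.+1%:R^-1 + nrm d (x_ n - x))) => [n|].
    rewrite -(subrKA (x_ n)) (le_trans (ler_nrmD _ _ _))// lerD2r.
    by have [] := vgP n.
  by rewrite -[X in _ --> X](addr0 0); exact: cvgD.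
- move=> i; apply: (@ncvg_le _ _ _ _ _ (fun n => n.+1%:R^-1 + nrm d (G_ n i - G i))) => [n|].
    rewrite -(subrKA (G_ n i)) (le_trans (ler_nrmD _ _ _))// lerD2r.
    by have [_ _] := vgP n; apply.
  by rewrite -[X in _ --> X](addr0 0); apply: cvgD => //; exact: GG.
Unshelve. all: by end_near. Qed.

Definition some_gradient x : I -> V := xget (fun=> 0) [set G | has_gradient x G].

Lemma some_gradientP x G : has_gradient x G -> has_gradient x (some_gradient x).
Proof.
move=> xG.
exact: (@xgetPex _ (fun=> 0) [set G | has_gradient x G] (ex_intro _ G xG)).
Qed.

Definition gradient_dot x y : R := \sum_i d (some_gradient x i) (some_gradient y i).

Lemma gradient_dotE x y G H : has_gradient x G -> has_gradient y H ->
  gradient_dot x y = \sum_i d (G i) (H i).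
Proof.
move=> xG yH; apply: eq_bigr => i _; apply/eqP; rewrite -subr_eq0.
have -> : d (some_gradient x i) (some_gradient y i) - d (G i) (H i) =
    d (some_gradient x i - G i) (some_gradient y i) +
    d (some_gradient y i - H i) (G i).
  by rewrite !dotBl !(dotC d (G i)) (dotC d (some_gradient y i) (G i)) (dotC d (H i)); ring.
rewrite !nrm0_dotl ?addr0//.
  exact: (gradient_unique i (some_gradientP yH) yH).
exact: (gradient_unique i (some_gradientP xG) xG).
Qed.

Definition gradient_dom : set V := [set x | exists G, has_gradient x G].

Lemma gradient_dom0 : gradient_dom 0.
Proof. by eexists; exact: has_gradient0. Qed.

Lemma gradient_dom_linear a x y : gradient_dom x -> gradient_dom y ->
  gradient_dom (a *: x + y).
Proof. by move=> [G xG] [H yH]; eexists; exact: (has_gradient_linear a xG yH). Qed.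

Lemma gradient_dotC x y : gradient_dom x -> gradient_dom y ->
  gradient_dot x y = gradient_dot y x.
Proof. by move=> _ _; apply: eq_bigr => i _; rewrite dotC. Qed.

Lemma gradient_dot_linear z a x y : gradient_dom x -> gradient_dom y -> gradient_dom z ->
  gradient_dot (a *: x + y) z = a * gradient_dot x z + gradient_dot y z.
Proof.
move=> [G xG] [H yH] [K zK].
rewrite (gradient_dotE (has_gradient_linear a xG yH) zK).
rewrite (gradient_dotE xG zK) (gradient_dotE yH zK) mulr_sumr -big_split.
by apply: eq_bigr => i _; rewrite dot_linear.
Qed.

(** The energy dominates each gradient component, so the gradients of the x_ n
    converge by completeness, and their limit is the gradient of x. *)
Lemma gradient_dot_closed (x_ : nat -> V) x : (forall n, gradient_dom (x_ n)) ->
  ncvg d x_ x ->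
  cauchy2 (fun m n => gradient_dot (x_ m - x_ n) (x_ m - x_ n)) ->
  gradient_dom x /\ forall v, gradient_dom v ->
    gradient_dot (x_ n) v @[n --> \oo] --> gradient_dot x v.
Proof.
move=> /choice[G_ xG] xx cG.
have /choice[G GG] i : exists Gi, ncvg d (fun n => G_ n i) Gi.
  apply: cplt; apply/cvgr0Pnorm_le => e e0.
  have e20 : 0 < e ^+ 2 by rewrite exprn_gt0.
  have /cvgr0Pnorm_le/(_ _ e20) := cG; apply: filterS => -[m n] /=.
  rewrite (gradient_dotE (has_gradientB (xG m) (xG n)) (has_gradientB (xG m) (xG n))).
  move=> le_e; rewrite ger0_norm ?nrm_ge0// -(@ler_pXn2r _ 2) ?nnegrE ?nrm_ge0 ?(ltW e0)//.
  rewrite sqr_nrm (le_trans _ le_e)// (le_trans _ (ler_norm _))//.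
  by rewrite (bigD1 i)//= lerDl sumr_ge0// => j _; exact: dot_ge0.
have xG' := has_gradient_closed xG xx GG.
split; first by exists G.
move=> v [H vH]; rewrite (gradient_dotE xG' vH).
under eq_fun do rewrite (gradient_dotE (xG _) vH).
apply: (@cvg_big _ _ _ _ _ add_continuous) => i _.
exact: (cvg_dot (GG i) (ncvg_cst d (H i))).
Qed.

Definition gradient_form : closed_form d :=
  ClosedForm gradient_dom0 gradient_dom_linear gradient_dotC gradient_dot_linear
    gradient_dot_closed.

End GradientForm.

(** * Test functions on a bounded domain *)

Section FiniteMeasure.
Context {R : realType}.

Definition tuple_cube n (r : R) : set (n.-tuple (measurableTypeR R)) :=
  [set t | forall i, `|tnth t i| <= r].

Lemma measurable_tuple_cube n r : measurable (@tuple_cube n r).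
Proof.
rewrite (_ : tuple_cube _ = \bigcap_(i in [set: 'I_n])
    (fun t : n.-tuple (measurableTypeR R) => tnth t i) @^-1` [set x | `|x| <= r]).
  apply: fin_bigcap_measurable; first exact: finite_finset.
  move=> i _; rewrite -[X in measurable X]setTI; apply: measurable_tnth => //.
  rewrite (_ : mkset _ = `[- r, r]%classic)//.
  by apply/seteqP; split => x /=; rewrite in_itv/= ler_norml.
by apply/seteqP; split => t ht i; [move=> _|]; exact: ht.
Qed.

Lemma lebesgue_tuple_cube n r : (@lebesgue_tuple R n (tuple_cube r) < +oo)%E.
Proof.
elim: n => [|n IH]; first by rewrite /= diracE ltry.
rewrite /= /lebesgue_cons /pushforward.
rewrite [X in product_measure1 _ _ X](_ : _ = `[- r, r]%classic `*` @tuple_cube n r).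
  rewrite product_measure1E//; last exact: measurable_tuple_cube.
  have itv_fin : (lebesgue_measure (`[(- r)%R, r]%classic : set R) < +oo)%E.
    by rewrite lebesgue_measure_itv/=; case: ifP => _; rewrite ?ltry// ltry.
  by apply: lte_mul_pinfty => //; rewrite ge0_fin_numE//; exact: itv_fin.
apply/seteqP; split => -[x t] /=.
  move=> tr; split; last by move=> i; have := tr (lift ord0 i); rewrite tnthS.
  by have := tr ord0; rewrite in_itv/= -ler_norml tnth0.
rewrite in_itv/= -ler_norml => -[xr tr] i.
by case: (unliftP ord0 i) => [j ->|->]; rewrite ?tnthS ?tnth0.
Qed.

End FiniteMeasure.

Section Domain.
Context {R : realType} {N : nat} (Omega : bounded_domain R N).
Local Notation fn := ('rV[R]_N -> R).
Local Notation mu := (lebesgue_on Omega).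

Lemma lebesgue_on_finite : (mu setT < +oo)%E.
Proof.
rewrite /lebesgue_on /= /mrestr setTI /lebesgue_rV /pushforward.
have [M [Mreal Mb]] := domain_bounded Omega.
pose r := M + 1.
have Or x : domain_set Omega x -> `|x| <= r by apply: Mb; rewrite ltrDl.
apply: (le_lt_trans _ (lebesgue_tuple_cube N r)).
apply: le_measure; rewrite ?inE.
- rewrite -[X in measurable X]setTI; apply: measurable_row_of_tuple => //.
  exact: open_measurable_rV (domain_open Omega).
- exact: measurable_tuple_cube.
move=> t /Or tr i; apply: le_trans tr.
have := @le_bigmax _ _ _ 0 (fun ij : 'I_1 * 'I_N => `|row_of_tuple t ij.1 ij.2|) (ord0, i).
by rewrite [`|row_of_tuple t|]mx_normrE /= mxE.
Qed.

Lemma continuous_bounded_L2 (f : fn) (C : R) : continuous f ->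
  (forall x, `|f x| <= C) -> f \in L2 Omega.
Proof.
move=> cf fC.
have mf : measurable_fun setT f.
  apply: (measurability _ (RGenOpens.measurableE R)).
  move=> _ [_ [a [b ->] <-]]; rewrite setTI; apply: open_measurable_rV.
  by move/continuousP : cf; apply; exact: interval_open.
apply: Lfun2_integral => //.
apply: (@le_lt_trans _ _ (\int[mu]_x (C ^+ 2)%:E)%E).
  apply: ge0_le_integral => //.
  - by move=> x _; rewrite lee_fin sqr_ge0.
  - by apply/measurable_EFinP; exact: measurable_funX.
  - move=> x _; rewrite lee_fin -[leLHS]real_normK ?num_real// lerXn2r ?nnegrE//.
    exact: le_trans (normr_ge0 _) (fC x).
rewrite integral_cst// lte_mul_pinfty// ?lee_fin ?sqr_ge0//.
exact: lebesgue_on_finite.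
Qed.

Lemma test_bounded (v : fn) : test_function Omega v ->
  exists C : R, forall x, `|v x| <= C.
Proof.
move=> [sv csv _].
have cv : continuous v by have [] := sv [::].
have [M [_ vM]] : bounded_set (v @` closure [set x | v x != 0]).
  apply: compact_bounded; apply: continuous_compact => //.
  exact: continuous_subspaceT.
exists (`|M| + 1) => x; have [->|vx] := eqVneq (v x) 0.
  by rewrite normr0 addr_ge0.
apply: (vM (`|M| + 1)).
  by rewrite (le_lt_trans (ler_norm _))// ltrDl.
by exists x => //; exact: subset_closure.
Qed.

Lemma test_L2 (v : fn) : test_function Omega v -> v \in L2 Omega.
Proof.
move=> tv; have [C vC] := test_bounded tv.
by apply: continuous_bounded_L2 vC; have [sv _ _] := tv; have [] := sv [::].
Qed.

Lemma test_support (v w : fn) : test_function Omega v -> smooth w ->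
  closure [set x | w x != 0] `<=` closure [set x | v x != 0] -> test_function Omega w.
Proof.
move=> [_ cv vO] sw wv; split => //; last exact: subset_trans vO.
by apply: subclosed_compact wv => //; exact: closed_closure.
Qed.

(** Off the closed support, v vanishes in a neighbourhood, and so does its
    derivative. *)
Lemma test_partial (v : fn) i : test_function Omega v ->
  test_function Omega (partial i v).
Proof.
move=> tv; have [sv _ _] := tv; apply: test_support tv _ _.
  by move=> l; have := sv (rcons l i); rewrite foldr_rcons.
rewrite [X in _ `<=` X](iffLR (closure_id (closure _)) (@closed_closure _ _)).
apply: closureS => x /= vx; apply: contrapT => xv.
move/eqP : vx; apply; rewrite /partial.
rewrite (@near_eq_derive _ _ _ _ (cst 0)) ?derive_cst//.
have : nbhs x (~` closure [set x | v x != 0]).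
  by apply: open_nbhs_nbhs; split => //; rewrite openC; exact: closed_closure.
apply: filterS => y /= vy; apply/eqP; apply: contrapT => /negP vy0.
by apply: vy; exact: subset_closure.
Qed.

Lemma foldr_partial_linear (a : R) (v w : fn) l : smooth v -> smooth w ->
  foldr partial (a *: v + w) l = a *: foldr partial v l + foldr partial w l.
Proof.
move=> sv sw; elim: l => [//|i l /= ->]; apply/funext => x; rewrite /partial.
have [_ dv] := sv l; have [_ dw] := sw l.
rewrite deriveD//; last by apply: derivableZ; exact: dv.
by rewrite deriveZ.
Qed.

Lemma smooth_linear (a : R) (v w : fn) : smooth v -> smooth w -> smooth (a *: v + w).
Proof.
move=> sv sw l; rewrite foldr_partial_linear//.
have [cv dv] := sv l; have [cw dw] := sw l; split.
  move=> x; apply: continuousD; last exact: cw.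
  by apply: continuousZr; exact: cv.
by move=> x i; apply: derivableD => //; apply: derivableZ.
Qed.

Lemma test_linear (a : R) (v w : fn) : test_function Omega v -> test_function Omega w ->
  test_function Omega (a *: v + w).
Proof.
move=> [sv cv vO] [sw cw wO].
have vw : closure [set x | (a *: v + w) x != 0] `<=`
    closure [set x | v x != 0] `|` closure [set x | w x != 0].
  rewrite -closureU; apply: closureS => x /= vwx.
  have [vx|vx] := eqVneq (v x) 0; last by left.
  right; move: vwx; have -> : (a *: v + w) x = a * v x + w x by [].
  by rewrite vx mulr0 add0r.
split; first exact: smooth_linear.
  apply: subclosed_compact vw; first exact: closed_closure.
  exact: compactU.
by move=> x /vw[/vO|/wO].
Qed.

Lemma test0 : test_function Omega (0 : fn).
Proof.
have D0 (l : seq 'I_N) : foldr partial (0 : fn) l = cst 0.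
  by elim: l => //= i l ->; apply/funext => x; rewrite /partial derive_cst.
split.
- by move=> l; rewrite D0; split => [|x i]; [exact: cst_continuous|exact: derivable_cst].
- rewrite (_ : mkset _ = set0) ?closure0; first exact: compact0.
  by apply/seteqP; split => // x /=; rewrite eqxx.
- rewrite (_ : mkset _ = set0) ?closure0//.
  by apply/seteqP; split => // x /=; rewrite eqxx.
Qed.

Lemma norm2E (f : L2fun mu) : norm2 Omega f = nrm (L2inner mu) f.
Proof. by rewrite nrmL2. Qed.

Lemma inner2E (f g : L2fun mu) : inner2 Omega f g = L2inner mu f g.
Proof. by []. Qed.

Lemma cvg2E (f_ : nat -> L2fun mu) (f : L2fun mu) :
  cvg2 Omega f_ f <-> ncvg (L2inner mu) f_ f.
Proof. by rewrite /cvg2 /ncvg; under eq_fun do rewrite (norm2E (f_ _ - f)). Qed.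

Definition test_gradient (v : L2fun mu) (g : 'I_N -> L2fun mu) : Prop :=
  test_function Omega v /\ forall i, g i = partial i v :> fn.

Lemma test_gradient0 : test_gradient 0 (fun=> 0).
Proof.
split; first exact: test0.
by move=> i; apply/funext => x; rewrite /partial derive_cst.
Qed.

Lemma test_gradient_linear (a : R) v w g h : test_gradient v g -> test_gradient w h ->
  test_gradient (a *: v + w) (fun i => a *: g i + h i).
Proof.
move=> [tv vg] [tw wh]; split; first exact: test_linear.
move=> i; have [sv _ _] := tv; have [sw _ _] := tw.
rewrite -[RHS]/(foldr partial (a *: (v : fn) + w) [:: i]) foldr_partial_linear//=.
by rewrite -vg -wh.
Qed.

Lemma test_gradient_partial v g i : test_gradient v g -> exists h, test_gradient (g i) h.
Proof.
move=> [tv vg]; have tg : test_function Omega (g i) by rewrite vg; exact: test_partial.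
exists (fun j => Lfun_Sub (le1_2E R) (test_L2 (test_partial j tg))).
by split.
Qed.

Definition dirichlet : closed_form (L2inner mu) :=
  gradient_form test_gradient0 test_gradient_linear test_gradient_partial
    (@L2_complete _ _ _ mu).

End Domain.

(** * The Dirichlet form *)

Section DirichletForm.
Context {R : realType} {N : nat} (Omega : bounded_domain R N).
Local Notation fn := ('rV[R]_N -> R).
Local Notation mu := (lebesgue_on Omega).
Local Notation V := (L2fun mu).
Local Notation l2_gradient :=
  (has_gradient (L2inner mu) (test_gradient (Omega := Omega))).

Lemma L2_lift (f : fn) : f \in L2 Omega -> exists x : V, f = x :> fn.
Proof. by move=> fL2; exists (Lfun_Sub (le1_2E R) fL2). Qed.

Lemma has_gradientP (x : V) (G : 'I_N -> V) :
  H10_with_gradient Omega x (fun i => G i) <-> l2_gradient x G.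
Proof.
split=> [[_ _ wG [v_ [tv vx gG]]]|[wG [v_ [g_ [tv vx gG]]]]].
  split; first by move=> v g i [tv' vg]; rewrite -!inner2E vg wG.
  exists (fun k => Lfun_Sub (le1_2E R) (test_L2 (tv k))),
    (fun k i => Lfun_Sub (le1_2E R) (test_L2 (test_partial i (tv k)))).
  split=> [k||i]; [by split=> //; exact: tv|exact/cvg2E|apply/cvg2E; exact: gG].
split; [exact: L2funP|by move=> i; exact: L2funP| |].
  move=> i v tv'.
  pose v' : V := Lfun_Sub (le1_2E R) (test_L2 tv').
  pose g' j : V := Lfun_Sub (le1_2E R) (test_L2 (test_partial j tv')).
  have : test_gradient v' g' by split.
  exact: wG.
exists (fun k : nat => ((v_ k : L2fun mu) : fn)); split; first by move=> k; have [] := tv k.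
  exact/cvg2E.
move=> i; have /cvg2E := gG i; congr (cvg2 Omega _ _).
by apply/funext => k; have [_ ->] := tv k.
Qed.

Lemma H10_gradient (f : fn) (G : 'I_N -> fn) : H10_with_gradient Omega f G ->
  exists (x : V) (G' : 'I_N -> V),
    [/\ f = x, G = (fun i => G' i) & l2_gradient x G'].
Proof.
move=> fG; have [fL2 GL2 _ _] := fG.
have [x fx] := L2_lift fL2; have /choice[G' GG'] := fun i => L2_lift (GL2 i).
have GE : G = (fun i => G' i) by exact/funext.
by exists x, G'; split=> //; apply/has_gradientP; rewrite -fx -GE.
Qed.

Lemma H10P (x : V) : H10 Omega x <-> dom (dirichlet Omega) x.
Proof.
split=> [[G]|[G xG]]; last by exists (fun i => ((G i : L2fun mu) : fn)); exact/has_gradientP.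
move=> /H10_gradient[y [G' [xy _ yG']]]; exists G'.
suff -> : x = y by [].
by apply: val_inj; exact: xy.
Qed.

Lemma H10_L2 (f : fn) : H10 Omega f -> f \in L2 Omega.
Proof. by case=> G []. Qed.

Lemma gradientP (x : V) : H10 Omega x ->
  exists2 G : 'I_N -> V, gradient Omega x = (fun i => G i) & l2_gradient x G.
Proof.
move=> xH; have := @xgetPex _ (fun _ _ => 0) [set G | H10_with_gradient Omega x G] xH.
rewrite -/(gradient Omega x) => /= xG; have [_ GL2 _ _] := xG.
have /choice[G GG] := fun i => L2_lift (GL2 i).
have GE : gradient Omega x = (fun i => G i) by exact/funext.
by exists G => //; apply/has_gradientP; rewrite -GE.
Qed.

Lemma Rintegral_sum_mul n (f g : 'I_n -> V) :
  \int[mu]_x (\sum_i f i x * g i x) = \sum_i L2inner mu (f i) (g i).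
Proof.
elim: n f g => [|n IH] f g.
  by under eq_Rintegral do rewrite big_ord0; rewrite big_ord0 Rintegral_cst ?mul0r.
under eq_Rintegral do rewrite big_ord_recl.
rewrite RintegralD//.
- by rewrite IH big_ord_recl.
- exact: integrable_mulL2.
- rewrite (_ : _ \o _ = fun x => (\sum_(i < n) (f (lift ord0 i) x * g (lift ord0 i) x)%:E)%E).
    by apply: integrable_sum => // i _; exact: integrable_mulL2.
  by apply/funext => x /=; rewrite sumEFin.
Qed.

Lemma dirichletE (x y : V) : H10 Omega x -> H10 Omega y ->
  dirichlet_form Omega x y = dirichlet Omega x y.
Proof.
move=> /gradientP[G xG xG'] /gradientP[H yH yH'].
rewrite /dirichlet_form xG yH Rintegral_sum_mul.
by rewrite [RHS](gradient_dotE (@test_gradient_linear _ _ Omega)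
  (@test_gradient_partial _ _ Omega) xG' yH').
Qed.

Lemma rayleighE (x : V) : H10 Omega x ->
  rayleigh Omega x = dirichlet Omega x x / L2inner mu x x.
Proof.
move=> xH; rewrite -dirichletE// /rayleigh; congr (_ / _).
Qed.

Lemma shifted_solutionP (sigma : R) (x y : V) :
  shifted_solution Omega sigma x y <-> solves (dirichlet Omega) sigma x y.
Proof.
split=> -[yH yx]; split; try by apply/H10P.
  by move=> v /H10P vH; rewrite -dirichletE ?yx//.
move=> v vH; have [w vw] := L2_lift (H10_L2 vH); subst v.
by rewrite dirichletE//; [apply: yx; exact/H10P|exact/H10P].
Qed.

Lemma eigenspaceP (lambda : R) (x : V) :
  Defs.eigenspace Omega lambda x <-> solves (dirichlet Omega) lambda 0 x.
Proof.
split=> -[xH ex]; split; try by apply/H10P.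
  by move=> v /H10P vH; rewrite -dirichletE// dot0l ex// subrr.
move=> v vH; have [w vw] := L2_lift (H10_L2 vH); subst v.
rewrite dirichletE//; last exact/H10P.
have := ex w; rewrite dot0l => /(_ (iffLR (H10P w) vH)) /eqP.
by rewrite subr_eq0 => /eqP.
Qed.

End DirichletForm.

(** * Ratios of eigenvalue distances *)

Section SpectralGap.
Context {R : realType} (M : option nat) (lam : nat -> R) (sigma : R) (s : nat).
Hypothesis lam_increasing : forall i j, in_range M j -> (i < j)%N -> lam i < lam j.
Hypothesis s_closest : closest_index M lam sigma s.
Hypothesis lam_s_neq : lam s != sigma.

(** Out of range the component of u is taken to be 0, and the value 0 of the
    multiplier keeps the bound on kappa uniform in j. *)
Definition kappa j : R := if in_range M j then (lam j - sigma)^-1 else 0.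

Definition rho j : R := (lam s - sigma) * kappa j.

Lemma dist_s_gt0 : 0 < `|lam s - sigma|.
Proof. by rewrite normr_gt0 subr_eq0. Qed.

Lemma kappa_le j : `|kappa j| <= `|lam s - sigma|^-1.
Proof.
rewrite /kappa; case: ifPn => [jM|_]; last by rewrite normr0 invr_ge0.
have [_ /(_ _ jM) le_sj] := s_closest.
by rewrite normfV lef_pV2 ?posrE// ?dist_s_gt0// (lt_le_trans dist_s_gt0).
Qed.

Lemma rho_s : rho s = 1.
Proof.
have [sM _] := s_closest.
by rewrite /rho /kappa sM divff// subr_eq0.
Qed.


Lemma norm_rho j : in_range M j -> `|rho j| = `|lam s - sigma| / `|lam j - sigma|.
Proof. by move=> jM; rewrite /rho /kappa jM normrM normfV. Qed.

Lemma rho_le1 j : `|rho j| <= 1.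
Proof.
by rewrite normrM mulrC -ler_pdivlMr ?dist_s_gt0// mul1r kappa_le.
Qed.

Lemma dist_gt0 j : in_range M j -> 0 < `|lam j - sigma|.
Proof.
by move=> jM; have [_ /(_ _ jM)] := s_closest; exact: lt_le_trans dist_s_gt0.
Qed.

Lemma rho_lt1 j : in_range M j ->
  (`|rho j| < 1) = (`|lam s - sigma| < `|lam j - sigma|).
Proof. by move=> jM; rewrite norm_rho// ltr_pdivrMr ?dist_gt0// mul1r. Qed.

Lemma lam_inj i j : in_range M i -> in_range M j -> lam i = lam j -> i = j.
Proof.
move=> iM jM ij; case: (ltngtP i j) => // lt_ij.
  by have := lam_increasing jM lt_ij; rewrite ij ltxx.
by have := lam_increasing iM lt_ij; rewrite ij ltxx.
Qed.

(** Finitely many ratios below 1 are bounded away from 1, so only the tail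
    matters.  If some J with |rho J| < 1 has lam J > sigma, the later
    eigenvalues are farther from sigma and |rho J| bounds their ratios.
    Otherwise an index j > s with |rho j| < 1 would satisfy
    lam s < lam j <= sigma and be closer to sigma than s. *)
Lemma rho_gap : exists2 q : R, 0 < q < 1 & forall j, `|rho j| < 1 -> `|rho j| <= q.
Proof.
have head J : exists2 q : R, 0 < q < 1 &
    forall j, (j < J)%N -> `|rho j| < 1 -> `|rho j| <= q.
  elim: J => [|J [q /andP[q0 q1] qJ]]; first by exists 2^-1 => //; lra.
  have [rJ|rJ] := ltP `|rho J| 1.
    exists (Num.max q `|rho J|); first by rewrite lt_max q0 gt_max q1.
    move=> j; rewrite ltnS leq_eqVlt le_max => /predU1P[->|jJ rj].
      by rewrite lexx orbT.
    by rewrite qJ.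
  exists q; first by rewrite q0.
  move=> j; rewrite ltnS leq_eqVlt => /predU1P[->|]; last exact: qJ.
  by rewrite ltNge rJ.
suff [J [q' q'1 tail]] : exists J, exists2 q' : R, q' < 1 &
    forall j, (J <= j)%N -> `|rho j| < 1 -> `|rho j| <= q'.
  have [q /andP[q0 q1] qJ] := head J.
  exists (Num.max q q'); first by rewrite lt_max q0 gt_max q1.
  move=> j rj; rewrite le_max; have [jJ|jJ] := ltnP j J; first by rewrite qJ.
  by rewrite tail ?orbT.
have out j : ~~ in_range M j -> `|rho j| <= 0.
  by move=> /negbTE jM; rewrite /rho /kappa jM mulr0 normr0.
have [[J [JM rJ Jsigma]]|noJ] :=
    pselect (exists J, [/\ in_range M J, `|rho J| < 1 & sigma < lam J]).
  exists J, `|rho J| => // j Jj _.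
  have [jM|/out rj] := boolP (in_range M j); last exact: le_trans rj _.
  rewrite !norm_rho// ler_wpM2l// lef_pV2 ?posrE ?dist_gt0//.
  have le_Jj : lam J <= lam j.
    by move: Jj; rewrite leq_eqVlt => /predU1P[->//|]; move/(lam_increasing jM)/ltW.
  by rewrite !gtr0_norm ?subr_gt0 ?lerB// (lt_le_trans Jsigma).
exists s.+1, 0 => // j sj rj.
have [jM|/out//] := boolP (in_range M j).
have js : lam j <= sigma by rewrite leNgt; apply/negP => ?; apply: noJ; exists j.
have sj' := lam_increasing jM sj.
have [_ /(_ _ jM)] := s_closest; rewrite leNgt => /negP[].
by rewrite !ler0_norm ?subr_le0// ?(ltW (lt_le_trans sj' js))//; lra.
Qed.

Lemma rho_neq_s j : j != s ->
  (forall j, in_range M j -> lam j != lam s -> `|lam s - sigma| < `|lam j - sigma|) ->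
  `|rho j| < 1.
Proof.
move=> js sep; have [jM|/negbTE jM] := boolP (in_range M j); last first.
  by rewrite /rho /kappa jM mulr0 normr0.
rewrite rho_lt1// sep//; apply: contra_neq js; apply: lam_inj => //.
by have [] := s_closest.
Qed.

(** If the second closest eigenvalue is as close as the first, the bound is
    1. *)
Lemma rho_second t j : second_closest_index M lam sigma s t -> j != s ->
  `|rho j| <= `|rho t|.
Proof.
move=> [tM ts tmin] js; have [jM|/negbTE jM] := boolP (in_range M j); last first.
  by rewrite {1}/rho /kappa jM mulr0 normr0.
rewrite !norm_rho// ler_wpM2l// lef_pV2 ?posrE ?dist_gt0// tmin//.
by apply: contra_neq js; apply: lam_inj => //; have [] := s_closest.
Qed.

End SpectralGap.

(** * The components of a function in the eigenspaces *)

Section Eigencomponents.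
Context {R : realType} {N : nat} (Omega : bounded_domain R N).
Local Notation fn := ('rV[R]_N -> R).
Local Notation mu := (lebesgue_on Omega).
Local Notation V := (L2fun mu).
Local Notation ip := (L2inner mu).

Lemma psum_val (E : nat -> V) (c : nat -> R) n :
  (psum E c n : V) = (fun x => \sum_(j < n) c j * E j x) :> fn.
Proof.
elim: n => [|n IH].
  by rewrite /psum big_ord0; apply/funext => x; rewrite big_ord0.
apply/funext => x; rewrite [RHS]big_ord_recr /= -(congr1 (fun f : fn => f x) IH).
by rewrite /psum big_ord_recr.
Qed.

Lemma eigen_solves (lambda sigma : R) (x : V) : lambda != sigma ->
  solves (dirichlet Omega) lambda 0 x ->
  solves (dirichlet Omega) sigma x ((lambda - sigma)^-1 *: x).
Proof.
move=> ls [xD ex].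
have ls0 : lambda - sigma != 0 by rewrite subr_eq0.
have D0 := dom0 (dirichlet Omega).
split; first by have := dom_linear (lambda - sigma)^-1 xD D0; rewrite addr0.
move=> v vD; have := form_linear (lambda - sigma)^-1 xD D0 vD.
rewrite addr0 => ->; have [_ /(_ _ vD)] := solves0 (dirichlet Omega) lambda.
move/eqP; rewrite dot0l mulr0 subr0 => /eqP ->.
have := ex v vD; rewrite dot0l dotZl => /eqP; rewrite subr_eq0 => /eqP ->.
by field.
Qed.

Lemma eigen_orth (lambda lambda' : R) (x y : V) : lambda != lambda' ->
  solves (dirichlet Omega) lambda 0 x -> solves (dirichlet Omega) lambda' 0 y ->
  ip x y = 0.
Proof.
move=> ll [xD ex] [yD ey].
have /eqP := ex y yD; have /eqP := ey x xD.
rewrite !dot0l !subr_eq0 (formC xD yD) (dotC ip y) => /eqP -> /eqP.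
move/eqP; rewrite -subr_eq0 -mulrBl mulf_eq0 subr_eq0 eq_sym (negbTE ll) /=.
by move/eqP.
Qed.

(** The components as vectors of L^2, extended by 0 so as to be indexed by all
    of nat.  Those in range are not null, because u is not orthogonal to
    their eigenspaces. *)
Lemma eigen_components (u : V) M lam (e : nat -> fn) :
  eigen_decomposition Omega u M lam e ->
  exists E : nat -> V,
  [/\ forall j, E j = (if in_range M j then e j else 0) :> fn,
      forall j, in_range M j -> solves (dirichlet Omega) (lam j) 0 (E j),
      forall j, in_range M j -> ip (E j) (E j) != 0,
      forall i j, i != j -> ip (E i) (E j) = 0 &
      expands ip E (fun=> 1) u].
Proof.
move=> [_ lam_incr lamP eP sumP].
have /choice[E EE] : forall j, exists x : V, x = (if in_range M j then e j else 0) :> fn.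
  move=> j; case: ifPn => jM; last by exists 0.
  have [[eH _] _] := eP j jM.
  by have [x xE] := L2_lift (H10_L2 eH); exists x.
have Eeig j : in_range M j -> solves (dirichlet Omega) (lam j) 0 (E j).
  by move=> jM; apply/eigenspaceP; rewrite EE jM; have [] := eP j jM.
exists E; split => //.
- move=> j jM; have [_ [v ev uv]] := iffRL (lamP (lam j)) (ex_intro2 _ _ j jM erefl).
  have [_ /(_ _ ev)] := eP j jM.
  have [x vx] := L2_lift (H10_L2 (proj1 ev)); subst v.
  have EjE := EE j; rewrite jM in EjE; rewrite -EjE.
  rewrite -[inner2 _ _ _]/(ip (u - E j) x) dotBl => /eqP; rewrite subr_eq0 => /eqP ux.
  move: uv; rewrite inner2E ux; apply: contra_neq => E0.
  by apply: nrm0_dotl; rewrite /nrm E0 sqrtr0.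
- move=> i j ij.
  have [iM|/negbTE iM] := boolP (in_range M i); last first.
    by rewrite (_ : E i = 0) ?dot0l//; apply: val_inj; have := EE i; rewrite iM.
  have [jM|/negbTE jM] := boolP (in_range M j); last first.
    by rewrite (_ : E j = 0) ?dot0r//; apply: val_inj; have := EE j; rewrite jM.
  apply: eigen_orth (Eeig _ iM) (Eeig _ jM).
  move: ij; rewrite neq_ltn => /orP[ij|ji].
    by rewrite lt_eqF// lam_incr.
  by rewrite gt_eqF// lam_incr.
- apply/cvg2E; move: sumP; congr (cvg2 _ _ _); apply/funext => n.
  rewrite psum_val; apply/funext => x; rewrite big_mkcond; apply: eq_bigr => j _.
  by rewrite mul1r EE; case: ifP.
Qed.

(** Once the series converges, [sum2] selects one of its limits, which differ
    by null vectors. *)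
Lemma sum2_expands (E : nat -> V) (f : nat -> fn) (c : nat -> R) (x : V) :
  (forall j, f j = (fun y => c j * E j y)) -> expands ip E c x ->
  exists2 y : V, sum2 Omega f = y & expands ip E c y.
Proof.
move=> fE cx.
have sumE : (fun n y => \sum_(j < n) f j y) = (fun n => (psum E c n : V) : fn).
  apply/funext => n; rewrite psum_val; apply/funext => y.
  by apply: eq_bigr => j _; rewrite fE.
have := @xgetPex _ (fun=> 0) [set g | g \in L2 Omega /\
  cvg2 Omega (fun n y => \sum_(j < n) f j y) g].
rewrite -/(sum2 Omega f) => /= -[].
  by exists (x : fn); split; [exact: L2funP|rewrite sumE; exact/cvg2E].
move=> /L2_lift[y ->]; rewrite sumE => /cvg2E cy; exists y => //.
Qed.

End Eigencomponents.

(** * Inverse iteration *)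

Section InverseIteration.
Context {R : realType} {N : nat} (Omega : bounded_domain R N).
Local Notation fn := ('rV[R]_N -> R).
Local Notation mu := (lebesgue_on Omega).
Local Notation V := (L2fun mu).
Local Notation ip := (L2inner mu).
Local Notation form := (dirichlet Omega).

Lemma iteration_lift sigma (u : V) (phi : nat -> fn) :
  inverse_iteration Omega sigma u phi ->
  exists Phi : nat -> V, [/\ phi = (fun n => Phi n), Phi 0%N = u &
    forall n, solves form sigma (Phi n) (Phi n.+1)].
Proof.
move=> [phi0 phiS].
have /choice[Phi PhiE] : forall n, exists x : V, phi n = x :> fn.
  case=> [|n]; first by exists u.
  by apply: L2_lift; apply: H10_L2; have [] := phiS n.
exists Phi; split; first exact/funext.
  by apply: val_inj; have := PhiE 0%N; rewrite phi0.
by move=> n; apply/shifted_solutionP; rewrite -!PhiE.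
Qed.

Lemma injective_of_noneigen sigma : ~ is_eigenvalue Omega sigma ->
  forall w : V, solves form sigma 0 w -> nrm ip w = 0.
Proof.
move=> noneigen w /eigenspaceP ew; apply/eqP; apply: contrapT => /negP w0.
by apply: noneigen; exists (w : fn) => //; rewrite norm2E.
Qed.

(** Testing the equation of y with y itself. *)
Lemma rayleigh_iterate sigma lambda (x y : V) : solves form sigma x y -> nrm ip y != 0 ->
  rayleigh Omega y - lambda = (ip x y - (lambda - sigma) * ip y y) / ip y y.
Proof.
move=> [yD yx] y0; rewrite rayleighE; last exact/H10P.
have -> : form y y = ip x y + sigma * ip y y by rewrite -yx// subrK.
by field; rewrite -sqr_nrm sqrf_eq0.
Qed.

Lemma normalize2E (x : V) : normalize2 Omega x = (direction ip x : V) :> fn.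
Proof. by apply/funext => y; rewrite /normalize2 norm2E mulrC. Qed.

Lemma componentE (u x : V) :
  component Omega u x = (ip u (direction ip x) *: direction ip x : V) :> fn.
Proof. by rewrite /component normalize2E inner2E. Qed.

(** Scaling changes the direction of x by a sign at most, which occurs
    twice. *)
Lemma component_scale (a : R) (u x : V) : a != 0 ->
  component Omega u x = component Omega u (a *: x).
Proof.
move=> a0; rewrite !componentE.
have -> : direction ip (a *: x) = (`|a|^-1 * a) *: direction ip x.
  by rewrite /direction nrmZ invfM !scalerA; congr (_ *: _); ring.
have sgn2 : (`|a|^-1 * a) * (`|a|^-1 * a) = 1.
  rewrite mulrACA -expr2 -expr2 exprVn real_normK ?num_real// mulVf//.
  by rewrite sqrf_eq0.
move: (`|a|^-1 * a) (direction ip x) sgn2 => c y cc.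
by rewrite dotZr scalerA mulrAC cc mul1r.
Qed.

Lemma exp_cvg2_geometric (f_ : nat -> V) (f : V) (C q : R) : 0 < C -> 0 < q < 1 ->
  (forall n, nrm ip (f_ n - f) <= C * q ^+ n) -> exp_cvg2 Omega f_ f.
Proof.
move=> C0 /andP[q0 q1] fC; split.
  apply/cvg2E; apply: (ncvg_le fC); rewrite -[X in _ --> X](mulr0 C).
  by apply: cvgM; [exact: cvg_cst|apply: cvg_expr; rewrite gtr0_norm].
exists C, q; split=> //; first by rewrite q0.
by apply: nearW => n; rewrite (norm2E (f_ n - f)).
Qed.

End InverseIteration.

Theorem theorem3 (R : realType) (N : nat) (N_gt0 : (0 < N)%N)
    (Omega : bounded_domain R N) (sigma : R) (sigma_gt0 : 0 < sigma)
    (sigma_noneigen : ~ is_eigenvalue Omega sigma)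
    (u : 'rV[R]_N -> R) (u_L2 : u \in L2 Omega) (u_neq0 : norm2 Omega u != 0)
    (M : option nat) (lam : nat -> R) (e : nat -> 'rV[R]_N -> R)
    (u_dec : eigen_decomposition Omega u M lam e)
    (s : nat) (s_closest : closest_index M lam sigma s)
    (phi : nat -> 'rV[R]_N -> R)
    (phi_iter : inverse_iteration Omega sigma u phi) :
  let psi_ := psi Omega M lam e sigma s in
  [/\ (* (i) *)
      (forall t, second_closest_index M lam sigma s t -> forall n,
         norm2 Omega (psi_ n) <=
           `|(lam s - sigma) / (lam t - sigma)| ^+ n * norm2 Omega u) /\
      exp_cvg2 Omega psi_ (fun=> 0),
      (* (ii) *)
      (exists n0 : nat, forall n, (n0 <= n)%N ->
         norm2 Omega (normalize2 Omega (e s \+ psi_ n)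
                        \- normalize2 Omega (e s)) <=
           4 / norm2 Omega (e s) * norm2 Omega (psi_ n)) /\
      exp_cvg2 Omega (fun n => normalize2 Omega (e s \+ psi_ n))
        (normalize2 Omega (e s)) &
      (* (iii) *)
      [/\ norm2 Omega (phi n) / norm2 Omega (phi n.+1) @[n --> \oo]
             --> `|lam s - sigma|,
          (forall j, in_range M j -> lam j != lam s ->
             `|lam s - sigma| < `|lam j - sigma|) ->
            cvg2 Omega (fun n => component Omega u (phi n)) (e s) /\
            rayleigh Omega (phi n) @[n --> \oo] --> lam s &
          forall t, second_closest_index M lam sigma s t ->
            (fun n => rayleigh Omega (phi n) - lam s) =O_\oo
              (fun n => `|(lam s - sigma) / (lam t - sigma)| ^+ (2 * n))]].
Proof.
move=> psi_.
have [u' uE] := L2_lift u_L2; subst u; rename u' into u.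
have [E [EE Eeig E_neq0 orthE uE]] := eigen_components u_dec.
have [Phi [-> Phi0 PhiS]] := iteration_lift phi_iter.
have inj := injective_of_noneigen sigma_noneigen.
have lam_incr := lam_increasing u_dec.
have sM : in_range M s by have [] := s_closest.
have esE : e s = E s by rewrite EE sM.
have lam_neq j : in_range M j -> lam j != sigma.
  move=> jM; apply: contra_not_neq sigma_noneigen => <-.
  by apply: (proj1 (iffRL (lam_spec u_dec (lam j)) _)); exists j.
have s_neq := lam_neq s sM.
pose delta := lam s - sigma.
have delta_neq0 : delta != 0 by rewrite subr_eq0.
pose ip := L2inner (lebesgue_on Omega).
pose k := kappa M lam sigma; pose r := rho M lam sigma s.
(* Induction on n; Phi 0 = u has all coefficients equal to 1. *)
have PhiE n : expands ip E (fun j => k j ^+ n) (Phi n).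
  elim: n => [|n IH]; first by rewrite Phi0; exact: uE.
  rewrite [X in expands _ _ X](_ : _ = fun j => k j ^+ n * k j); last first.
    by apply/funext => j; rewrite exprSr.
  apply: (solves_expands inj orthE (@L2_complete _ _ _ _) _
    (kappa_le s_closest s_neq) _ IH (PhiS n)).
    by rewrite invr_ge0.
  move=> j; rewrite /k /kappa; case: ifPn => [jM|jM].
    exact: eigen_solves (lam_neq j jM) (Eeig j jM).
  rewrite scale0r (_ : E j = 0); first exact: solves0.
  by apply: val_inj; have := EE j; rewrite (negbTE jM).
pose x_ n : L2fun (lebesgue_on Omega) := delta ^+ n *: Phi n.
have xE n : expands ip E (fun j => r j ^+ n) (x_ n).
  rewrite [X in expands _ _ X](_ : _ = fun j => delta ^+ n * k j ^+ n).
    exact: expandsZ.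
  by apply/funext => j; rewrite -exprMn.
have [q q01 rq] := rho_gap lam_incr s_closest s_neq.
have /andP[q0 q1] := q01.
have rs : r s = 1 by exact: rho_s.
have r1 j : `|r j| <= 1 by exact: rho_le1.
have /choice[Psi PsiP] : forall n, exists y : L2fun (lebesgue_on Omega),
    psi_ n = y :> ('rV[R]_N -> R) /\
    expands ip E (fun j => if `|r j| < 1 then r j ^+ n else 0) y.
  move=> n; pose c j := if `|r j| < 1 then r j ^+ n else 0.
  have [|g cg] := multiplier (b := c) orthE (@L2_complete _ _ _ _) ler01 uE.
    move=> j; rewrite mul1r normr1 /c; case: ifPn => _; last by rewrite normr0.
    by rewrite normrX exprn_ile1.
  have [|y yE cy] := sum2_expands (f := fun j x =>
      if in_range M j && (`|lam s - sigma| < `|lam j - sigma|)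
      then ((lam s - sigma) / (lam j - sigma)) ^+ n * e j x else 0) _ cg; last by exists y.
  move=> j; apply/funext => y; rewrite /c EE; case: ifPn => [/andP[jM sj]|].
    by rewrite jM /r rho_lt1// sj /rho /kappa jM.
  (* In range the two conditions agree; out of range the term is 0 whatever the
     coefficient. *)
  rewrite negb_and; case: (boolP (in_range M j)) => [jM|_ _] /=; last by rewrite mulr0.
  by rewrite /r rho_lt1// => /negbTE ->; rewrite mul0r.
have psiE : psi_ = (fun n => Psi n) by apply/funext => n; have [] := PsiP n.
have {PsiP} PsiE n : expands ip E (fun j => if `|r j| < 1 then r j ^+ n else 0) (Psi n).
  by have [] := PsiP n.
have Es0 := E_neq0 s sM.
have nEs0 : 0 < nrm ip (E s) by exact: nrm_Es_gt0.
have Psi_le p n : 0 <= p -> (forall j, `|r j| < 1 -> `|r j| <= p) ->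
    nrm ip (Psi n) <= p ^+ n * nrm ip u.
  exact: (ler_psi orthE uE PsiE).
have second t : second_closest_index M lam sigma s t ->
    `|(lam s - sigma) / (lam t - sigma)| = `|r t|.
  by move=> [tM _ _]; rewrite /r norm_rho// normrM normfV.
have dir_le n : nrm ip (direction ip (E s + Psi n) - direction ip (E s)) <=
    2 / nrm ip (E s) * nrm ip (Psi n).
  have sub_s : E s + Psi n - E s = Psi n by rewrite addrC addKr.
  by rewrite -[X in _ * nrm _ X]sub_s; exact: ler_direction.
have nu0 : 0 < nrm ip u by rewrite lt0r nrm_ge0 andbT -norm2E.
have second_le t : second_closest_index M lam sigma s t ->
    forall j, j != s -> `|r j| <= `|r t|.
  by move=> st j; exact: rho_second.
have r_neq_s j : `|r j| < 1 -> j != s.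
  by apply: contraTneq => ->; rewrite rs normr1 ltxx.
have xPhi n : nrm ip (Phi n) = `|delta| ^- n * nrm ip (x_ n).
  by rewrite nrmZ normrX mulrA mulVf ?mul1r// expf_neq0// normr_eq0.
have x_gt0 n : 0 < nrm ip (x_ n).
  exact: (lt_le_trans nEs0 (ler_Es_x orthE rs xE n)).
have ray n : rayleigh Omega (Phi n.+1) - lam s =
    delta * (ip (x_ n) (x_ n.+1) / ip (x_ n.+1) (x_ n.+1) - 1).
  have P0 : nrm ip (Phi n.+1) != 0.
    by rewrite xPhi mulf_neq0 ?gt_eqF// invr_gt0 exprn_gt0 ?normr_gt0.
  rewrite (rayleigh_iterate _ (PhiS n) P0) /x_ !dotZl !dotZr exprS -/delta.
  move: delta_neq0 P0; rewrite -sqr_nrm; clearbody delta => delta_neq0 P0; field.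
  by rewrite P0 delta_neq0 expf_neq0.
have ray_le (p : R) : 0 < p -> (forall j, j != s -> `|r j| <= p) ->
    exists2 K : R, 0 < K & forall n,
      `|rayleigh Omega (Phi n.+1) - lam s| <= K * p ^+ (2 * n.+1).
  move=> p0 rp; exists (`|delta| * ((1 + p^-1) * (nrm ip u / nrm ip (E s)) ^+ 2)).
    by rewrite !mulr_gt0 ?normr_gt0 ?addr_gt0 ?invr_gt0 ?exprn_gt0 ?divr_gt0.
  move=> n; rewrite ray normrM -mulrA ler_wpM2l//.
  exact: (ler_consecutive orthE uE rs xE Es0 n p0 rp).
rewrite psiE esE; split.
- split.
    move=> t st n; rewrite second// !norm2E; apply: Psi_le => // j /r_neq_s.
    exact: second_le.
  apply: (exp_cvg2_geometric (f := 0) nu0 q01) => n; rewrite subr0 mulrC.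
  exact: Psi_le (ltW q0) rq.
- split.
    exists 0%N => n _.
    rewrite (normalize2E (E s + Psi n)) normalize2E.
    rewrite (norm2E (direction ip (E s + Psi n) - direction ip (E s))) !norm2E.
    rewrite (le_trans (dir_le n))// ler_wpM2r ?nrm_ge0// ler_wpM2r ?invr_ge0 ?nrm_ge0//.
    by rewrite ler_nat.
  have C0 : 0 < 2 / nrm ip (E s) * nrm ip u by rewrite mulr_gt0 ?divr_gt0.
  rewrite normalize2E (_ : (fun n => _) = (fun n => direction ip (E s + Psi n)
    : L2fun (lebesgue_on Omega)) :> (nat -> 'rV[R]_N -> R)); last first.
    by apply/funext => n; rewrite (normalize2E (E s + Psi n)).
  apply: (exp_cvg2_geometric C0 q01) => n.
  rewrite (le_trans (dir_le n))// -[leRHS]mulrA ler_wpM2l ?divr_ge0 ?nrm_ge0// mulrC.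
  exact: Psi_le (ltW q0) rq.
split.
- have ratio := cvg_nrm_ratio orthE uE r1 rs xE PsiE Es0 q01 rq.
  have -> : (fun n => norm2 Omega (Phi n) / norm2 Omega (Phi n.+1)) =
      (fun n => `|delta| * (nrm ip (x_ n) / nrm ip (x_ n.+1))).
    apply/funext => n; rewrite !norm2E !xPhi exprS; field.
    by rewrite !gt_eqF// ?exprn_gt0 ?normr_gt0.
  rewrite -[X in _ --> X]mulr1; apply: cvgM => //; exact: cvg_cst.
- move=> sep.
  have rq_s j : j != s -> `|r j| <= q.
    by move=> js; apply: rq; apply: rho_neq_s js sep.
  split.
    have xEs := ncvg_x orthE uE rs xE q01 rq_s.
    have uEs : ip u (E s) = ip (E s) (E s).
      by rewrite (expands_coef orthE s uE) mul1r.
    have := ncvg_projection xEs Es0 uEs; move=> /cvg2E.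
    congr (cvg2 Omega _ _); apply/funext => n.
    by rewrite -componentE /x_ -component_scale// expf_neq0.
  have [K K0 rayK] := ray_le q q0 rq_s.
  apply/subr_cvg0; apply: norm_cvg0.
  rewrite -(cvg_shiftS (fun n => `|rayleigh Omega (Phi n) - lam s|)).
  apply: (@squeeze_cvgr _ _ _ _ (fun=> 0) (fun n => K * q ^+ n)).
  + apply: nearW => n; rewrite normr_ge0/= (le_trans (rayK n))// ler_wpM2l ?(ltW K0)//.
    by apply: ler_wiXn2l; rewrite ?(ltW q0) ?(ltW q1)//; rewrite mul2n -addnn addSn leqW// leq_addr.
  + exact: cvg_cst.
  + rewrite -[X in _ --> X](mulr0 K).
    by apply: cvgM; [exact: cvg_cst|apply: cvg_expr; rewrite gtr0_norm].
- move=> t st; rewrite second//.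
  have rt0 : 0 < `|r t|.
    have [tM _ _] := st.
    rewrite /r norm_rho// divr_gt0 ?normr_gt0// ?subr_eq0// lam_neq//.
  have [K K0 rayK] := ray_le _ rt0 (second_le t st).
  apply/eqO_exP; exists K => //.
  (* The formula for the Rayleigh quotient starts with the first iterate that
     solves an equation; u itself need not lie in H^1_0. *)
  exists 1%N => // -[//|n] _.
  by rewrite [X in _ <= _ * X]ger0_norm ?exprn_ge0.
Qed.
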